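(* Given $r\in\mathbb{N}$, $0<p\le\infty$ and $R>1$, there exists a constant $C(p,d,r,R)$ depending only on $p,d,r$ and $R$ such that $$\sup_{\Omega\in\mathcal{S}^d(R)}w_r(\Omega)_p\le C(p,d,r,R)<\infty.$$
   Context: Notation. $\|\cdot\|$ is the Euclidean norm on $\mathbb{R}^d$, $\mathbb{S}^{d-1}$ the unit sphere, $B_\rho[x]$ the closed ball of radius $\rho$ centered at $x$, $\mathbb{N}=\{1,2,\dots\}$. A set (domain) $\Omega\subset\mathbb{R}^d$ is star-shaped with respect to a ball $B$ if for each $x\in\Omega$ the closed convex hull of $\{x\}\cup B$ is contained in $\Omega$. For $R>1$, $\Omega\subset\mathbb{R}^d$ belongs to the class $\mathcal{S}^d(R)$ if there is an affine transformation $T:\mathbb{R}^d\to\mathbb{R}^d$ such that $T(\Omega)$ is star-shaped with respect to the unit ball $B_1[0]$ and is contained in the ball $B_R[0]$. For $0<p<\infty$, $L^p(\Omega)$ is the usual Lebesgue space; $L^\infty(\Omega):=C(\overline{\Omega})$ with the uniform norm. For a nonempty bounded measurable $\Omega\subset\mathbb{R}^d$, $h\in\mathbb{R}^d\setminus\{0\}$ put $\Omega_{r,h}:=\{x\in\Omega:x,x+h,\dots,x+rh\in\Omega\}$ and $\triangle_h^rf(x):=\sum_{j=0}^r(-1)^{r+j}\binom rj f(x+jh)$ for $x\in\Omega_{r,h}$. Let $\omega^r(f;\Omega)_p:=\sup_{\xi\in\mathbb{S}^{d-1}}\sup_{|u|\le\operatorname{diam}(\Omega)}\|\triangle^r_{u\xi}f\|_{L^p(\Omega_{r,u\xi})}$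 (the norm over an empty set is $0$). Let $\Pi^d_{r-1}$ be the space of real algebraic polynomials in $d$ variables of total degree at most $r-1$, $E_r(f)_{L^p(\Omega)}:=\inf\{\|f-q\|_{L^p(\Omega)}:q\in\Pi^d_{r-1}\}$, and define the Whitney constant $w_r(\Omega)_p:=\sup\{E_r(f)_{L^p(\Omega)}:f\in L^p(\Omega),\ \omega^r(f;\Omega)_p\le1\}$. *)

(* Defs.v *)
(* R^d is ['rV[R]_d]; its topology is the library's product
   topology.  The library norm on it is the max norm, so the Euclidean norm is
   [enorm] below. *)
From HB Require Import structures.
From mathcomp Require Import all_boot all_order all_algebra.
From mathcomp Require Import all_classical all_reals all_analysis.
From mathcomp Require mpoly.

Set Implicit Arguments.
Unset Strict Implicit.
Unset Printing Implicit Defensive.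

Import Order.TTheory GRing.Theory Num.Theory.
Import numFieldNormedType.Exports.

Local Open Scope classical_set_scope.
Local Open Scope ring_scope.

Section Geometry.
Context {R : realType} {d : nat}.
Implicit Types (x y : 'rV[R]_d) (Omega : set 'rV[R]_d).

Definition enorm x : R := Num.sqrt (\sum_i x ord0 i ^+ 2).

Definition eball x (rho : R) : set 'rV[R]_d := [set y | enorm (y - x) <= rho].

Definition esphere : set 'rV[R]_d := [set x | enorm x = 1].

Definition ediam Omega : \bar R :=
  ereal_sup [set (enorm (x - y))%:E | x in Omega & y in Omega].

Definition closed_convex_hull (A : set 'rV[R]_d) : set 'rV[R]_d :=
  smallest [set C | @convex_set R 'rV[R]_d C /\ closed C] A.

Definition star_shaped Omega (B : set 'rV[R]_d) : Prop :=
  forall x, Omega x -> closed_convex_hull (x |` B) `<=` Omega.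

Definition affine_map (A : 'M[R]_d) (b : 'rV[R]_d) x : 'rV[R]_d := x *m A + b.

(* The class S^d(rho); affine transformations are the invertible affine maps. *)
Definition star_class (rho : R) : set (set 'rV[R]_d) :=
  [set Omega | exists (A : 'M[R]_d) (b : 'rV[R]_d),
    [/\ A \in unitmx,
        star_shaped (affine_map A b @` Omega) (eball 0 1) &
        affine_map A b @` Omega `<=` eball 0 rho]].

End Geometry.

(* The Lebesgue measure on R^(d+1), as the outer measure obtained from countable
   covers by half-open boxes, restricted to its Caratheodory measurable sets.  The
   dimension is positive, so that there are boxes of volume 0. *)
Section LebesgueMeasure.
Local Open Scope ereal_scope.
Context {R : realType} {d : nat}.
Local Notation V := 'rV[R]_d.+1.

Definition box (c : V * V) : set V :=
  [set x | forall i, x ord0 i \in `]c.1 ord0 i, c.2 ord0 i] ].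

Definition box_vol (c : V * V) : \bar R :=
  (\prod_i Num.max (c.2 ord0 i - c.1 ord0 i) 0)%:E.

Definition box_cover (A : set V) : set (nat -> V * V) :=
  [set c | A `<=` \bigcup_k box (c k)].

Definition lebesgue_outer (A : set V) : \bar R :=
  ereal_inf [set \sum_(k <oo) box_vol (c k) | c in box_cover A].

Lemma box_vol_ge0 c : 0 <= box_vol c.
Proof.
by rewrite lee_fin; apply: prodr_ge0 => i _; rewrite le_max lexx orbT.
Qed.

Lemma box_vol0 : box_vol (0%R, 0%R) = 0.
Proof. by rewrite /box_vol big_ord_recl /= subrr maxxx mul0r. Qed.

Lemma lebesgue_outer_ge0 A : 0 <= lebesgue_outer A.
Proof.
apply: le_ereal_inf_tmp => _ [c _ <-].
by apply: nneseries_ge0 => k _ _; exact: box_vol_ge0.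
Qed.

Lemma lebesgue_outer0 : lebesgue_outer set0 = 0.
Proof.
apply/eqP; rewrite eq_le lebesgue_outer_ge0 andbT.
apply: ereal_inf_lbound; exists (fun=> (0%R, 0%R)); first by [].
by apply: eseries0 => k _ _; exact: box_vol0.
Qed.

Lemma le_lebesgue_outer :
  {homo lebesgue_outer : A B / A `<=` B >-> A <= B}.
Proof.
move=> A B AB; apply/ereal_inf_le_tmp => _ [c Bc <-].
by exists c => //; exact: subset_trans AB Bc.
Qed.

Lemma lebesgue_outer_sigma_subadditive : sigma_subadditive lebesgue_outer.
Proof.
move=> A; have [[i ioo]|] := pselect (exists i, lebesgue_outer (A i) = +oo).
  rewrite (eseries_pinfty _ _ ioo) ?leey// => n _.
  by rewrite -ltNye (lt_le_trans _ (lebesgue_outer_ge0 _)).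
rewrite -forallNE => Aoo.
apply/lee_addgt0Pr => _/posnumP[e].
rewrite (le_trans _ (epsilon_trick _ _ _))//; last first.
  by move=> n; exact: lebesgue_outer_ge0.
pose P n (c : nat -> V * V) := box_cover (A n) c /\
  \sum_(k <oo) box_vol (c k)
    <= lebesgue_outer (A n) + (e%:num / (2 ^ n.+1)%:R)%:E.
have [G PG] : {G : nat -> nat -> V * V & forall n, P n (G n)}.
  apply: (@choice _ _ P) => n; rewrite /P.
  have fA : lebesgue_outer (A n) \is a fin_num.
    rewrite ge0_fin_numE ?lebesgue_outer_ge0// ltey; exact/eqP/Aoo.
  have en1 : (0 < e%:num / (2 ^ n.+1)%:R :> R)%R by [].
  have [_ [c Ac <-] /ltW ?] := lb_ereal_inf_adherent en1 fA.
  by exists c.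
pose v (i : nat * nat) := box_vol (G i.1 i.2).
have v_ge0 i : 0 <= v i by exact: box_vol_ge0.
apply: (@le_trans _ _ (\esum_(i in setT) v i)).
  apply: ereal_inf_lbound => /=.
  have /card_esym/ppcard_eqP[f] := card_nat2.
  exists (fun k => G (f k).1 (f k).2).
    move=> t [i _ /((PG i).1)[j _ Gt]].
    by exists (f^-1%FUN (i, j)) => //=; rewrite invK ?inE.
  rewrite -(esum_pred_image v f xpredT) ?[fun=> _]set_true//.
  by rewrite image_eq.
rewrite (_ : esum _ _ = \sum_(i <oo) \sum_(j <oo) box_vol (G i j)); last first.
  pose J : nat -> set (nat * nat) := fun i => [set (i, j) | j in setT].
  rewrite (_ : setT = \bigcup_k J k); last first.
    by rewrite predeqE => -[a b]; split => // _; exists a => //; exists b.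
  rewrite esum_bigcupT //=; last first.
    apply/trivIsetP => i j _ _ ij.
    rewrite predeqE => -[n m] /=; split => //= -[] [_] _ [<-{n} _].
    by move=> [m' _] [] /esym/eqP; rewrite (negbTE ij).
  rewrite -(image_id [set: nat]) -fun_true esum_pred_image//; last first.
    by move=> n _; exact: esum_ge0.
  apply: eq_eseriesr => /= j _.
  rewrite -(esum_pred_image v (pair j) predT)//=; last first.
    by move=> ? ? _ _; exact: (@can_inj _ _ _ snd).
  by congr esum; rewrite predeqE => -[a b]; split; move=> [i _ <-]; exists i.
apply: lee_nneseries => [n _ _|n _]; last exact: (PG n).2.
by apply: nneseries_ge0 => m _ _; exact: box_vol_ge0.
Qed.

HB.instance Definition _ := isOuterMeasure.Build R V lebesgue_outer
  lebesgue_outer0 lebesgue_outer_ge0 le_lebesgue_outer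
  lebesgue_outer_sigma_subadditive.

Definition lebesgue_type : measurableType _ :=
  caratheodory_type lebesgue_outer.

Definition lebesgue_rV : set lebesgue_type -> \bar R := lebesgue_outer.

HB.instance Definition _ := isMeasure.Build _ lebesgue_type R lebesgue_rV
  (@caratheodory_measure0 R V lebesgue_outer)
  (@caratheodory_measure_ge0 R V lebesgue_outer)
  (@caratheodory_measure_sigma_additive R V lebesgue_outer).

End LebesgueMeasure.

Section Whitney.
(* The notations of mpoly clash with those of MathComp-Analysis. *)
Import -(notations) mpoly.
Context {R : realType} {d : nat}.
Local Notation V := 'rV[R]_d.+1.
Implicit Types (p : \bar R) (Omega : set V) (f : V -> R) (h : V) (r : nat).

(* Functions on Omega are total functions on R^(d+1) whose values outside Omega
   (outside its closure when p = +oo) are irrelevant: the restriction [f \_ Omega]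
   extends f by 0 outside Omega. *)
Definition Lp_norm p Omega f : \bar R :=
  if p == +oo%E
  then ereal_sup (0%E |` [set `|f x|%:E | x in closure Omega])
  else Lnorm lebesgue_rV p (EFin \o (f \_ Omega)).

(* L^oo(Omega) denotes C(closure Omega). *)
Definition Lp_space p Omega : set (V -> R) :=
  [set f | if p == +oo%E
           then {within closure Omega, continuous f}
           else f \_ Omega \in Lfun lebesgue_rV p].

Definition difference_domain Omega r h : set V :=
  [set x | forall j, (j <= r)%N -> Omega (x + h *+ j)].

Definition finite_difference r h f : V -> R :=
  fun x => \sum_(j < r.+1) (-1) ^+ (r + j) * 'C(r, j)%:R * f (x + h *+ j).

Definition modulus r f Omega p : \bar R :=
  ereal_sup [set ereal_sup
      [set Lp_norm p (difference_domain Omega r (u *: xi))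
                     (finite_difference r (u *: xi) f)
        | u in [set u : R | (`|u|%:E <= ediam Omega)%E]]
    | xi in esphere].

(* [mpoly.msize q] is 1 + the total degree of q, and 0 for q = 0. *)
Definition poly_space r : set (mpoly d.+1 R) :=
  [set q : mpoly d.+1 R | (mpoly.msize q <= r)%N].

Definition poly_fun (q : mpoly d.+1 R) : V -> R :=
  fun x => mpoly.meval (x ord0) q.

Definition best_approx r f Omega p : \bar R :=
  ereal_inf [set Lp_norm p Omega (f \- poly_fun q) | q in poly_space r].

Definition whitney_constant r Omega p : \bar R :=
  ereal_sup [set best_approx r f Omega p
    | f in [set f | Lp_space p Omega f /\ (modulus r f Omega p <= 1)%E]].

End Whitney.

(* Main.v *)
(* After an affine change of coordinates Omega lies in a fixed ball and is
   star-shaped with respect to a cube of fixed size.  Kemperman's identity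
   writes a mixed r-th difference as a sum of ordinary r-th differences, so all
   mixed differences with small steps are bounded on a smaller cube K.  If the
   mixed differences of order m + 1 are bounded, then averaging over the last
   step (Tonelli) brings each difference of order m close on K to a constant,
   and these constants are symmetric and almost additive in every step; by
   Hyers-Ulam stability they are close to a symmetric m-linear form.
   Subtracting the homogeneous polynomial polarized by that form makes the
   differences of order m bounded, and descending to m = 0 gives a polynomial
   close to f on K.  Since f(x) is the difference of step -c/r at x minus a
   combination of the values of f at points nearer to K, where c is the centre
   of a small cell containing x, the bound then spreads from K to Omega in
   finitely many steps.  The L^p quasinorm enters only through a few properties
   shared with the sup norm, which are recorded in [gauge]. *)
From HB Require Import structures.
Require Import Defs.
From mathcomp Require Import all_boot all_order all_algebra.
From mathcomp Require Import all_classical all_reals all_analysis.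
From mathcomp Require Import ring lra zify.
From mathcomp Require Import measurable_realfun.
From mathcomp Require mpoly.

Set Implicit Arguments.
Unset Strict Implicit.
Unset Printing Implicit Defensive.

Import Order.TTheory GRing.Theory Num.Theory.
Import numFieldNormedType.Exports.
Import -(notations) mpoly.

Local Open Scope classical_set_scope.
Local Open Scope ring_scope.

(** * Mixed differences of functions and signed sums of steps *)

Section MixedDifferences.
Context {R : realType} {V : lmodType R}.
Implicit Types (f g : V -> R) (h x : V) (hs : seq V).

(** The affine map may distort Omega arbitrarily, yet the constant must not see it. So sizes are
    taken in the coordinates of that map and rescaled to give [cube s] size 1; the parameters of
    [gauge] then depend on p, d and r alone, and every constant is fixed before the map, the domain
    and f. For p < 1 a function of L^p need not be locally integrable and has no mean value; the
    constant close to it is its value at a point found by Tonelli. Additive functions can be wild;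
    they are excluded by the size of f on K, which is finite but uncontrolled, so it is used
    qualitatively and never enters a constant. Neither the measurability of Omega nor the joint
    measurability of f(x + h) is given: the former is derived from star-shapedness, the latter holds
    after a change of f on a null set. The scales are eta = 1/(d + 1), the half-side of a cube
    inside the unit ball of dimension d + 1, and s = eta / (2 (r + 1)^2): steps up to 2 s join any
    two points of [cube s], and all points occurring in Kemperman's identity for such steps stay
    within 2 s (r + 1)^2 = eta. *)

Definition fdiff h f : V -> R := fun x => f (x + h) - f x.

Definition mdiff hs f : V -> R := foldr fdiff f hs.

Lemma fdiff_comm h k f : fdiff h (fdiff k f) = fdiff k (fdiff h f).
Proof. by apply/funext => x; rewrite /fdiff (addrAC x); ring. Qed.

Lemma mdiff_fdiff hs k f : mdiff hs (fdiff k f) = fdiff k (mdiff hs f).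
Proof. by elim: hs => //= h hs ->; exact: fdiff_comm. Qed.

Lemma mdiff_cat hs ks f : mdiff (hs ++ ks) f = mdiff hs (mdiff ks f).
Proof. by rewrite /mdiff foldr_cat. Qed.

Lemma mdiff_perm hs ks f : perm_eq hs ks ->
  mdiff hs f = mdiff ks f.
Proof.
apply: (catCA_perm_subst (F := fun l => mdiff l f)) => s1 s2 s3.
rewrite !mdiff_cat; elim: s1 (mdiff s3 f) => //= h s1 IH g.
by rewrite IH mdiff_fdiff.
Qed.

Lemma mdiffD hs f g x :
  mdiff hs (fun y => f y + g y) x = mdiff hs f x + mdiff hs g x.
Proof.
by elim: hs x => //= h hs IH x; rewrite /fdiff !IH; ring.
Qed.

Lemma mdiffB hs f g x :
  mdiff hs (fun y => f y - g y) x = mdiff hs f x - mdiff hs g x.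
Proof.
by elim: hs x => //= h hs IH x; rewrite /fdiff !IH; ring.
Qed.

Lemma mdiffZ hs a f x : mdiff hs (fun y => a * f y) x = a * mdiff hs f x.
Proof.
by elim: hs x => //= h hs IH x; rewrite /fdiff !IH; ring.
Qed.

Lemma mdiff_sum (I : Type) (s : seq I) hs (F : I -> V -> R) x :
  mdiff hs (fun y => \sum_(i <- s) F i y) x = \sum_(i <- s) mdiff hs (F i) x.
Proof.
elim: hs x => //= h hs IH x; rewrite /fdiff !IH.
by rewrite -sumrB.
Qed.

Lemma mdiff0 hs f : 0 \in hs -> mdiff hs f = cst 0.
Proof.
elim: hs => //= h hs IH; rewrite inE => /orP[/eqP<-|/IH ->].
  by apply/funext => x; rewrite /fdiff addr0 subrr.
by apply/funext => x; rewrite /fdiff /= subrr.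
Qed.

Definition linear_form (l : V -> R) := forall x y, l (x + y) = l x + l y.

(* Leibniz rule for the product of [P] with a linear form. *)
Lemma mdiff_linear_mul hs (l P : V -> R) x : linear_form l ->
  mdiff hs (fun y => l y * P y) x = l x * mdiff hs P x +
  \sum_(i < size hs) l (nth 0 hs i) *
     mdiff (take i hs ++ drop i.+1 hs) P (x + nth 0 hs i).
Proof.
move=> ladd; elim: hs x => [|h hs IH] x /=; first by rewrite big_ord0 addr0.
rewrite /fdiff !IH big_ord_recl /= drop0 ladd.
under [in RHS]eq_bigr => i _ do rewrite ?lift0 /fdiff.
set A := \sum_(i < _) _; set B := \sum_(i < _) _; set C := \sum_(i < _) _.
suff -> : C = A - B by rewrite /fdiff; ring.
rewrite /A /B /C -sumrB; apply: eq_bigr => i _.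
by rewrite -mulrBr [x + h + _]addrAC.
Qed.

(* [annihilated n P] : P behaves as a polynomial of degree less than n. *)
Definition annihilated n (P : V -> R) :=
  forall hs x, size hs = n -> mdiff hs P x = 0.

Lemma annihilatedS n P : annihilated n P -> annihilated n.+1 P.
Proof. by move=> nP [//|h hs] x [shs] /=; rewrite /fdiff !nP// subrr. Qed.

(** In the Leibniz rule each remaining term has spent one of its n + 1 steps on the linear form, so
    a difference of order n of [P] is left. *)
Lemma annihilated_linear_mul n l P : linear_form l -> annihilated n P ->
  annihilated n.+1 (fun y => l y * P y).
Proof.
move=> ladd nP hs x shs; rewrite mdiff_linear_mul//.
rewrite (annihilatedS nP)// mulr0 add0r big1// => i _.
have li := ltn_ord i; rewrite nP ?mulr0// size_cat size_take size_drop li.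
by lia.
Qed.

(* A list of pairs [(a_i, b_i)] is expanded into the signed list of the sums
   [sum_(i in S) (a_i, b_i)] over all index sets [S]. *)
Fixpoint signed_sums (l : seq (V * V)) : seq (R * (V * V)) :=
  if l is p :: l' then
    [seq (t.1, t.2 + p) | t <- signed_sums l'] ++
    [seq (- t.1, t.2) | t <- signed_sums l']
  else [:: (1, (0, 0))].

(** Steps that depend affinely on [k] have sums that do so too, with signs and pairs independent of
    [k]. This permits the exchange with the sum over [k] in Kemperman's identity. *)
Lemma mdiff_signed_sums l k f x :
  mdiff [seq p.1 + p.2 *+ k | p <- l] f x =
  \sum_(t <- signed_sums l) t.1 * f (x + t.2.1 + t.2.2 *+ k).
Proof.
elim: l x => [|p l IH] x /=.
  by rewrite big_seq1 /= mul0rn !addr0 mul1r.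
rewrite /fdiff !IH big_cat !big_map /= -sumrN; congr (_ + _).
  apply: eq_bigr => t _; congr (_ * f _).
  rewrite mulrnDl -!addrA; congr (_ + _); rewrite [in RHS]addrCA.
  by congr (_ + _); rewrite addrCA (addrC (p.2 *+ k)).
by apply: eq_bigr => t _; rewrite mulNr.
Qed.

Lemma size_signed_sums l : size (signed_sums l) = (2 ^ size l)%N.
Proof.
by elim: l => //= p l IH; rewrite size_cat !size_map IH addnn -mul2n expnS.
Qed.

Lemma signed_sums_le (N : V -> R) l t : N 0 = 0 ->
  (forall x, 0 <= N x) -> (forall x y, N (x + y) <= N x + N y) ->
  t \in signed_sums l ->
  [/\ `|t.1| = 1, N t.2.1 <= \sum_(p <- l) N p.1 & N t.2.2 <= \sum_(p <- l) N p.2].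
Proof.
move=> N0 Nge0 ND; elim: l t => [|p l IH] t /=.
  by rewrite inE => /eqP -> /=; rewrite !big_nil normr1 N0.
rewrite mem_cat => /orP[] /mapP[u /IH[u1 u2 u3] ->] /=; rewrite !big_cons.
  by split => //; rewrite (le_trans (ND _ _))// [leRHS]addrC lerD2r.
rewrite normrN; split => //; rewrite (le_trans _ (lerD (Nge0 _) (lexx _)))//;
  by rewrite add0r.
Qed.

End MixedDifferences.

(** * Kemperman's identity; polynomial functions of bounded degree *)

Section Polynomials.
Context {R : realType} {d : nat}.
Local Notation V := 'rV[R]_d.+1.
Implicit Types (f g : V -> R) (h x : V) (hs : seq V).

Definition kemperman_list hs : seq (V * V) :=
  mkseq (fun i => (nth 0 hs i, - (i.+1%:R^-1 *: nth 0 hs i))) (size hs).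

(* Kemperman's identity: in the [j]-th summand of the finite difference the
   [j]-th step is multiplied by [1 - j/j = 0], so only [j = 0] contributes. *)
Lemma kemperman hs f x :
  mdiff hs f x = \sum_(t <- signed_sums (kemperman_list hs))
    ((-1) ^+ size hs * t.1) *
    finite_difference (size hs) t.2.2 f (x + t.2.1).
Proof.
set r := size hs.
under eq_bigr => t _ do rewrite /finite_difference mulr_sumr.
rewrite exchange_big /=.
transitivity (\sum_(j < r.+1) (-1) ^+ j * 'C(r, j)%:R *
    mdiff [seq p.1 + p.2 *+ j | p <- kemperman_list hs] f x); last first.
  apply: eq_bigr => j _; rewrite mdiff_signed_sums mulr_sumr.
  apply: eq_bigr => t _; rewrite exprD.
  have s1 : (-1) ^+ r * (-1) ^+ r = 1 :> R by rewrite -expr2 sqrr_sign.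
  by ring: s1.
rewrite big_ord_recl [X in _ + X]big1 ?addr0.
  rewrite bin0 expr0 !mul1r; congr (mdiff _ f x).
  rewrite -map_comp -[LHS](mkseq_nth 0).
  by congr map; apply/funext => i /=; rewrite mulr0n addr0.
move=> j _; rewrite lift0.
(* After [lift0] the summand has index j + 1, and the pair of index j, whose divisor is j + 1,
   provides the zero step. *)
rewrite mdiff0 ?mulr0//; apply/mapP.
exists (nth 0 hs j, - (j.+1%:R^-1 *: nth 0 hs j)).
  by apply/mapP; exists (j : nat); rewrite ?mem_iota ?ltn_ord.
by rewrite /= mulNrn -scaler_nat scalerA divff ?scale1r ?subrr// pnatr_eq0.
Qed.

(** Pascal's rule matches the recursion of [mdiff]. Through this the r-th differences of a
    polynomial of degree less than r vanish. *)
Lemma finite_difference_mdiff r h f x :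
  finite_difference r h f x = mdiff (nseq r h) f x.
Proof.
elim: r x => [|r IH] x.
  by rewrite /finite_difference big_ord1 /= bin0 !mul1r mulr0n addr0.
rewrite -[nseq r.+1 h]/(h :: nseq r h) -[mdiff _ _ _]/(fdiff h (mdiff (nseq r h) f) x).
rewrite /fdiff -!IH /finite_difference big_ord_recl.
under eq_bigr => j _ do rewrite lift0 binS natrD mulrDr mulrDl.
rewrite big_split /= addrA addrC; congr (_ + _).
  apply: eq_bigr => j _; rewrite mulrS addrA; congr (_ * _ * _).
  by rewrite addSn addnS !exprS !mulN1r opprK.
transitivity (\sum_(j < r.+2) (-1) ^+ (r.+1 + j) * 'C(r, j)%:R * f (x + h *+ j)).
  by rewrite [RHS]big_ord_recl /= !bin0.
rewrite big_ord_recr /= bin_small// mulr0 mul0r addr0 -sumrN.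
by apply: eq_bigr => j _; rewrite addSn exprS mulN1r !mulNr.
Qed.

Definition poly_of_degree_lt n (P : V -> R) :=
  exists2 q : mpoly d.+1 R, poly_space n q & P = poly_fun q.

(** An induction principle over a strict degree bound. Vanishing of differences, boundedness on
    cubes, measurability, continuity and stability under affine substitution are all obtained from
    it. *)
Lemma poly_fun_ind (P : nat -> (V -> R) -> Prop) :
  (forall n, P n (cst 0)) -> (forall n c, P n.+1 (cst c)) ->
  (forall n f g, P n f -> P n g -> P n (fun x => f x + g x)) ->
  (forall n i f, P n f -> P n.+1 (fun x => x ord0 i * f x)) ->
  (forall n f c, P n f -> P n (fun x => c * f x)) ->
  forall n q, poly_space n q -> P n (poly_fun q).
Proof.
move=> P0 Pc PD PX PZ n q nq.
have monomial (s : seq 'I_d.+1) (m : 'I_d.+1 -> nat) k :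
    (\sum_(i <- s) m i < k)%N -> P k (fun x => \prod_(i <- s) x ord0 i ^+ m i).
  elim: s k => [|j s IH] k.
    case: k => // k _; rewrite (_ : (fun _ => _) = cst 1); first exact: Pc.
    by apply/funext => x; rewrite big_nil.
  rewrite big_cons.
  rewrite (_ : (fun _ => _) =
    (fun x => x ord0 j ^+ m j * \prod_(i <- s) x ord0 i ^+ m i)); last first.
    by apply/funext => x; rewrite big_cons.
  elim: (m j) k => [|e IHe] k.
    rewrite add0n => /IH; congr (P _ _); apply/funext => x.
    by rewrite expr0 mul1r.
  case: k => // k; rewrite addSn ltnS => /IHe /(PX _ j); congr (P _ _).
  by apply/funext => x; rewrite exprS mulrA.
rewrite (_ : poly_fun q = (fun x => \sum_(m <- msupp q)
    mcoeff m q * \prod_i x ord0 i ^+ m i)); last first.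
  by apply/funext => x; rewrite /poly_fun mevalE.
have : forall m, m \in msupp q -> (\sum_i m i < n)%N.
  by move=> m /msize_mdeg_lt; rewrite mdegE => /leq_trans; apply.
elim: (msupp q : seq (multinom d.+1)) => [|m s IH] sn.
  rewrite (_ : (fun _ => _) = cst 0); first exact: P0.
  by apply/funext => x; rewrite big_nil.
rewrite (_ : (fun _ => _) = (fun x => mcoeff m q * \prod_i x ord0 i ^+ m i +
  \sum_(m <- s) mcoeff m q * \prod_i x ord0 i ^+ m i)); last first.
  by apply/funext => x; rewrite big_cons.
apply: PD; last by apply: IH => m' ms; apply: sn; rewrite inE ms orbT.
by apply/PZ/monomial/sn; rewrite inE eqxx.
Qed.

Lemma poly_fun_annihilated r (q : mpoly d.+1 R) : poly_space r q ->
  annihilated r (poly_fun q).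
Proof.
move: r q; apply: poly_fun_ind.
- by move=> n hs x _; elim: hs x => //= h hs IH x; rewrite /fdiff !IH subrr.
- move=> n c; elim: n => [|n IH]; last exact: annihilatedS.
  by move=> [//|h [|//]] x _ /=; rewrite /fdiff subrr.
- by move=> n f g nf ng hs x shs; rewrite mdiffD nf// ng// addr0.
- move=> n i f nf; apply: annihilated_linear_mul => // x y.
  by rewrite mxE.
- by move=> n f c nf hs x shs; rewrite mdiffZ nf// mulr0.
Qed.

Lemma poly_of_degree_lt0 n : poly_of_degree_lt n (cst 0).
Proof.
exists (mpolyC d.+1 0); last by apply/funext => x; rewrite /poly_fun mevalC.
by rewrite /poly_space /= mmeasureC eqxx.
Qed.

Lemma poly_of_degree_lt_cst n c : poly_of_degree_lt n.+1 (cst c).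
Proof.
exists (mpolyC d.+1 c); last by apply/funext => x; rewrite /poly_fun mevalC.
by rewrite /poly_space /= mmeasureC; case: (_ == _).
Qed.

Lemma poly_of_degree_ltD n f g : poly_of_degree_lt n f -> poly_of_degree_lt n g ->
  poly_of_degree_lt n (fun x => f x + g x).
Proof.
move=> [p np ->] [q nq ->]; exists (p + q).
  by rewrite /poly_space /= (leq_trans (mmeasureD_le _ _ _))// geq_max np.
by apply/funext => x; rewrite /poly_fun mevalD.
Qed.

Lemma poly_of_degree_ltZ n c f : poly_of_degree_lt n f ->
  poly_of_degree_lt n (fun x => c * f x).
Proof.
move=> [p np ->]; exists (c *: p).
  by rewrite /poly_space /= (leq_trans (msizeZ_le _ _)).
by apply/funext => x; rewrite /poly_fun mevalZ.
Qed.

Lemma poly_of_degree_ltW m n f : (m <= n)%N -> poly_of_degree_lt m f ->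
  poly_of_degree_lt n f.
Proof.
by move=> mn [p np ->]; exists p => //; rewrite /poly_space /= (leq_trans np).
Qed.

Lemma poly_of_degree_lt_sum (I : finType) n (F : I -> V -> R) :
  (forall i, poly_of_degree_lt n.+1 (F i)) ->
  poly_of_degree_lt n.+1 (fun x => \sum_i F i x).
Proof.
move=> nF; elim: (index_enum I) => [|i s IH].
  rewrite (_ : (fun _ => _) = cst 0); first exact: poly_of_degree_lt_cst.
  by apply/funext => x; rewrite big_nil.
rewrite (_ : (fun _ => _) = (fun x => F i x + \sum_(i <- s) F i x)); last first.
  by apply/funext => x; rewrite big_cons.
exact: poly_of_degree_ltD.
Qed.

(** The matrix serves affine substitution; the identity matrix gives multiplication by a
    coordinate. *)
Lemma poly_of_degree_lt_coord (A : 'M[R]_d.+1) j n f :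
  poly_of_degree_lt n f ->
  poly_of_degree_lt n.+1 (fun x => (x *m A) ord0 j * f x).
Proof.
move=> [p np ->].
rewrite (_ : (fun _ => _) =
  (fun x => \sum_i A i j * (x ord0 i * poly_fun p x))); last first.
  apply/funext => x; rewrite mxE mulr_suml; apply: eq_bigr => i _; ring.
apply: poly_of_degree_lt_sum => i; apply: poly_of_degree_ltZ.
exists (mpolyX R (mnm1 i) * p); last first.
  by apply/funext => x; rewrite /poly_fun mevalM mevalXU.
rewrite /poly_space /=; have [->|p0] := eqVneq p 0.
  by rewrite mulr0 mmeasure0.
have X0 : mpolyX R (mnm1 i) != 0 by rewrite -(mmeasure_poly_eq0 mdeg) msizeX.
by rewrite msizeM// msizeX mdeg1.
Qed.

End Polynomials.

(** * The max norm and coordinates *)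

Section SupNorm.
Context {R : realType} {d : nat}.
Local Notation V := 'rV[R]_d.+1.
Implicit Types x : V.

Lemma coord_le_norm x i : `|x ord0 i| <= `|x|.
Proof.
rewrite [leRHS]mx_normrE.
apply: (le_bigmax_cond _ (fun ij => `|x ij.1 ij.2|) (j := (ord0, i))).
by [].
Qed.

Lemma norm_le_coord x c : 0 <= c -> (forall i, `|x ord0 i| <= c) -> `|x| <= c.
Proof.
move=> c0 xc; rewrite [leLHS]mx_normrE; apply/bigmax_leP; split => // -[i j] _ /=.
by rewrite (ord1 i).
Qed.

End SupNorm.

(** * Hyers-Ulam stability of additive and multiadditive functions *)

Section Stability.
Context {R : realType} {d : nat}.
Local Notation V := 'rV[R]_d.+1.

(* Hyers--Ulam stability on an interval; boundedness replaces continuity. *)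
Lemma additive_stable_line (phi : R -> R) (tau delta M : R) : 0 < delta ->
  (forall s t, `|s| <= delta -> `|t| <= delta -> `|s + t| <= delta ->
    `|phi (s + t) - phi s - phi t| <= tau) ->
  (forall t, `|t| <= delta -> `|phi t| <= M) ->
  forall t, `|t| <= delta -> `|phi t - t / delta * phi delta| <= 8 * tau.
Proof.
move=> delta0 addphi bndphi.
(* Subtracting a linear function keeps the additivity defect and makes the value at [delta]
   vanish. *)
pose chi t := phi t - t / delta * phi delta.
have addchi s t : `|s| <= delta -> `|t| <= delta -> `|s + t| <= delta ->
    `|chi (s + t) - chi s - chi t| <= tau.
  move=> sd td std; rewrite /chi.
  by rewrite (_ : _ - _ - _ = phi (s + t) - phi s - phi t) ?addphi//; ring.
have chi_delta : chi delta = 0 by rewrite /chi divff ?gt_eqF// mul1r subrr.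
pose S := [set `|chi t| | t in [set t | `|t| <= delta]].
have S0 : `|0 : R| <= delta by rewrite normr0 ltW.
have Sub : has_ubound S.
  exists (M + M) => _ [t /= td <-]; rewrite (le_trans (ler_normB _ _))// lerD ?bndphi//.
  rewrite !normrM normfV (gtr0_norm delta0).
  rewrite (le_trans _ (bndphi delta _)) ?(gtr0_norm delta0)//.
  by rewrite ler_piMl// ler_pdivrMr// mul1r.
have chiS t : `|t| <= delta -> `|chi t| <= sup S.
  by move=> td; apply: (ub_le_sup Sub); exists t.
have chi0 : `|chi 0| <= tau.
  by have := addchi 0 0 S0 S0; rewrite addr0 => /(_ S0); rewrite subrr sub0r normrN.
(* Doubling the argument halves the supremum on the half interval. The outer half is reached by a
   translation by delta / 2, where [chi] is at most tau / 2, and negative arguments by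
   reflection. *)
have half t : `|t| <= delta / 2 -> `|chi t| <= (tau + sup S) / 2.
  move=> td; have td' : `|t| <= delta by lra.
  have ttd : `|t + t| <= delta by rewrite (le_trans (ler_normD _ _))//; lra.
  have := addchi t t td' td' ttd; have := chiS _ ttd.
  rewrite !ler_norml => /andP[? ?] /andP[? ?]; apply/andP; split; lra.
have chih : `|chi (delta / 2)| <= tau / 2.
  have hd : `|delta / 2| <= delta by rewrite gtr0_norm; lra.
  have hh : `|delta / 2 + delta / 2| <= delta by rewrite -splitr gtr0_norm; lra.
  have := addchi _ _ hd hd hh; rewrite -splitr chi_delta.
  rewrite !ler_norml => /andP[? ?]; apply/andP; split; lra.
have pos t : 0 <= t -> t <= delta -> `|chi t| <= 2 * tau + sup S / 2.
  move=> t0 td; have tau0 : 0 <= tau by rewrite (le_trans _ chi0).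
  have [th|/ltW th] := leP t (delta / 2).
    rewrite (le_trans (half _ _)) ?ger0_norm//; lra.
  have h1 : `|t - delta / 2| <= delta / 2 by rewrite ger0_norm; lra.
  have h2 : `|delta / 2| <= delta by rewrite gtr0_norm; lra.
  have h3 : `|t - delta / 2| <= delta by lra.
  have h4 : `|delta / 2 + (t - delta / 2)| <= delta.
    by rewrite addrCA subrr addr0 ger0_norm.
  have := addchi _ _ h2 h3 h4; rewrite addrCA subrr addr0.
  move: chih (half _ h1); rewrite !ler_norml.
  move=> /andP[? ?] /andP[? ?] /andP[? ?]; apply/andP; split; lra.
have all t : `|t| <= delta -> `|chi t| <= 4 * tau + sup S / 2.
  move=> td; have tau0 : 0 <= tau by rewrite (le_trans _ chi0).
  have [t0|/ltW t0] := leP 0 t.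
    by rewrite (le_trans (pos _ t0 _)) ?lerD2r ?ler_wpM2r//;
      move: td; rewrite ger0_norm//; lra.
  have ntd : `|- t| <= delta by rewrite normrN.
  have := addchi _ _ td ntd; rewrite subrr => /(_ S0).
  have : `|chi (- t)| <= 2 * tau + sup S / 2 by apply: pos; [lra|move: td; rewrite ler0_norm].
  move: chi0; rewrite !ler_norml.
  move=> /andP[? ?] /andP[? ?] /andP[? ?]; apply/andP; split; lra.
(* The supremum bounds itself with factor 1/2, whence 8 tau. [M] has served only to make it
   finite. *)
have S8 : sup S <= 4 * tau + sup S / 2.
  by apply: ge_sup; [exists `|chi 0|; exists 0|move=> _ [t td <-]; exact: all].
move=> t td; rewrite (le_trans (chiS _ td))//; lra.
Qed.

Local Notation e i := (delta_mx ord0 i : V).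

Definition truncate k (h : V) : V := \row_i (if (i < k)%N then h ord0 i else 0).

Lemma truncate_le k h : `|truncate k h| <= `|h|.
Proof.
apply: norm_le_coord => // i; rewrite mxE; case: ifP => _; last by rewrite normr0.
exact: coord_le_norm.
Qed.

Lemma truncateS (k : 'I_d.+1) h :
  truncate k.+1 h = truncate k h + h ord0 k *: e k.
Proof.
apply/rowP => i; rewrite !mxE eqxx /= ltnS leq_eqVlt -val_eqE /=.
rewrite val_eqE; have [->|_] := eqVneq i k; last by rewrite mulr0 addr0.
by rewrite ltnn add0r mulr1.
Qed.

Lemma norm_scale_e a (i : 'I_d.+1) : `|a *: e i| = `|a|.
Proof.
apply/eqP; rewrite eq_le; apply/andP; split.
  apply: norm_le_coord => // j; rewrite !mxE eqxx /=.
  by case: (j == i); rewrite ?mulr1// mulr0 normr0.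
by rewrite (le_trans _ (coord_le_norm _ i))// !mxE !eqxx mulr1.
Qed.

(** Adding the coordinates one at a time costs one [tau] each, plus one for the origin; the
    truncations stay in the ball because the norm is the max norm. On each coordinate line the
    interval case costs 8 more. *)
Lemma additive_stable (phi : V -> R) (tau delta M : R) : 0 < delta ->
  (forall h k, `|h| <= delta -> `|k| <= delta -> `|h + k| <= delta ->
    `|phi (h + k) - phi h - phi k| <= tau) ->
  (forall h, `|h| <= delta -> `|phi h| <= M) ->
  forall h, `|h| <= delta ->
    `|phi h - \sum_j h ord0 j / delta * phi (delta *: e j)|
      <= (1 + 9 * d.+1%:R) * tau.
Proof.
move=> delta0 addphi bndphi h hd.
have sum_le k : (k <= d.+1)%N ->
    `|phi (truncate k h) - \sum_(j < d.+1 | (j < k)%N) phi (h ord0 j *: e j)|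
      <= (1 + k%:R) * tau.
  elim: k => [_|k IH kd].
    rewrite big_pred0 ?subr0// (_ : truncate 0 h = 0); last by apply/rowP => i; rewrite !mxE.
    have z : `|0 : V| <= delta by rewrite normr0 ltW.
    have := addphi 0 0 z z; rewrite addr0 => /(_ z).
    by rewrite subrr sub0r normrN addr0 mul1r.
  pose i := Ordinal kd; rewrite (bigD1 i)//= (eq_bigl (fun j : 'I_d.+1 => (j < k)%N)); last first.
    by move=> j; rewrite ltnS -val_eqE /= ltn_neqAle andbC.
  have hk : `|h ord0 i *: e i| <= delta.
    by rewrite norm_scale_e (le_trans (coord_le_norm _ _)).
  have tk j : `|truncate j h| <= delta by rewrite (le_trans (truncate_le _ _)).
  have := addphi _ _ (tk k) hk; rewrite -(truncateS i) => /(_ (tk _)) /=.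
  move: (IH (ltnW kd)); rewrite -natr1; set s := \sum_(_ < _ | _) _.
  rewrite !ler_norml => /andP[? ?] /andP[? ?]; apply/andP; split; lra.
have := sum_le d.+1 (leqnn _).
rewrite (_ : truncate _ h = h); last first.
  by apply/rowP => i; rewrite mxE ltn_ord.
rewrite (eq_bigl predT); last by move=> i; rewrite ltn_ord.
have : `|\sum_(j < d.+1) phi (h ord0 j *: e j) -
    \sum_j h ord0 j / delta * phi (delta *: e j)| <= 8 * d.+1%:R * tau.
  rewrite -sumrB (le_trans (ler_norm_sum _ _ _))//.
  apply: (@le_trans _ _ (\sum_(j < d.+1) 8 * tau)); last first.
    by rewrite sumr_const card_ord -[leLHS]mulr_natr mulrAC.
  apply: ler_sum => j _.
  apply: (@additive_stable_line (fun t => phi (t *: e j)) tau delta M) => //.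
  - move=> s t sd td std; rewrite scalerDl.
    by apply: addphi; rewrite -?scalerDl norm_scale_e.
  - by move=> t td; apply: bndphi; rewrite norm_scale_e.
  - exact: le_trans (coord_le_norm _ _) hd.
set a := phi h; set b := \sum_j phi _; set c := \sum_j _.
rewrite !ler_norml => /andP[? ?] /andP[? ?]; apply/andP; split; lra.
Qed.

(** For nonzero [delta], the multilinear form that agrees with [phi] on lists of vectors
    [delta *: e j]. The recursion freezes the first argument of [phi], so inductions must generalize
    over [phi]. *)
Fixpoint mlin (delta : R) (hs : seq V) (phi : seq V -> R) : R :=
  if hs is h :: hs' then
    \sum_j h ord0 j / delta * mlin delta hs' (fun t => phi (delta *: e j :: t))
  else phi [::].

Definition symmetric_fun (phi : seq V -> R) :=
  forall hs ks, perm_eq hs ks -> phi hs = phi ks.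

Lemma symmetric_fun_cons phi h : symmetric_fun phi ->
  symmetric_fun (fun t => phi (h :: t)).
Proof. by move=> sym hs ks hk; apply: sym; rewrite perm_cons. Qed.

Definition ball_seq (delta : R) m : set (seq V) :=
  [set hs | size hs = m /\ {in hs, forall h, `|h| <= delta}].

Lemma ball_seq_cons delta m h hs : `|h| <= delta -> ball_seq delta m hs ->
  ball_seq delta m.+1 (h :: hs).
Proof.
move=> hd [shs hsd]; split; first by rewrite /= shs.
by move=> k; rewrite inE => /orP[/eqP ->//|]; exact: hsd.
Qed.

Lemma ball_seq_perm delta m hs ks : perm_eq hs ks ->
  ball_seq delta m hs -> ball_seq delta m ks.
Proof.
move=> hk [shs hsd]; split; first by rewrite -shs (perm_size hk).
by move=> k; rewrite -(perm_mem hk); exact: hsd.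
Qed.

Lemma ball_seq_behead delta m h hs : ball_seq delta m.+1 (h :: hs) ->
  `|h| <= delta /\ ball_seq delta m hs.
Proof.
move=> [[shs] hsd]; split; first by rewrite hsd// mem_head.
by split => // k khs; rewrite hsd// inE khs orbT.
Qed.

Lemma multiadditive_stable (delta : R) m : 0 < delta -> exists2 C : R, 0 <= C &
  forall (phi : seq V -> R) (tau M : R), 0 <= tau -> symmetric_fun phi ->
  (forall h k hs, ball_seq delta m (h :: hs) -> ball_seq delta m (k :: hs) ->
     ball_seq delta m (h + k :: hs) ->
    `|phi (h + k :: hs) - phi (h :: hs) - phi (k :: hs)| <= tau) ->
  (forall hs, ball_seq delta m hs -> `|phi hs| <= M) ->
  forall hs, ball_seq delta m hs -> `|phi hs - mlin delta hs phi| <= C * tau.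
Proof.
move=> delta0; elim: m => [|m [C C0 IH]].
  exists 0 => // phi tau M _ _ _ _ [|h hs [//]] _ /=.
  by rewrite subrr normr0 mul0r.
exists (1 + 9 * d.+1%:R + d.+1%:R * C).
  by rewrite addr_ge0// ?mulr_ge0// addr_ge0// mulr_ge0.
move=> phi tau M tau0 sym addphi bndphi [[]//|h hs] /ball_seq_behead[hd hsd] /=.
have ed j : `|delta *: e j| <= delta by rewrite norm_scale_e gtr0_norm.
have := @additive_stable (fun h => phi (h :: hs)) tau delta M delta0.
have H1 h1 k1 : `|h1| <= delta -> `|k1| <= delta -> `|h1 + k1| <= delta ->
    `|phi (h1 + k1 :: hs) - phi (h1 :: hs) - phi (k1 :: hs)| <= tau.
  by move=> ? ? ?; apply: addphi; exact: ball_seq_cons.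
have H2 h1 : `|h1| <= delta -> `|phi (h1 :: hs)| <= M.
  by move=> ?; apply: bndphi; exact: ball_seq_cons.
move=> /(_ H1 H2 h hd) le1.
have le2 : `|\sum_j h ord0 j / delta * phi (delta *: e j :: hs) -
    \sum_j h ord0 j / delta * mlin delta hs (fun t => phi (delta *: e j :: t))|
    <= d.+1%:R * C * tau.
  rewrite -sumrB (le_trans (ler_norm_sum _ _ _))//.
  apply: (@le_trans _ _ (\sum_(j < d.+1) C * tau)); last first.
    by rewrite sumr_const card_ord -[leLHS]mulr_natl mulrA.
  apply: ler_sum => j _; rewrite -mulrBr normrM.
  rewrite (@le_trans _ _ (`|phi (delta *: e j :: hs) -
    mlin delta hs (fun t => phi (delta *: e j :: t))|))//.
    rewrite ler_piMl// normrM normfV (gtr0_norm delta0).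
    by rewrite ler_pdivrMr// mul1r (le_trans (coord_le_norm _ _)).
  apply: (IH _ tau M) => //; first exact: symmetric_fun_cons.
    move=> h1 k1 t ht kt hkt.
    have swap u : phi [:: delta *: e j, u & t] = phi [:: u, delta *: e j & t].
      by apply: sym; rewrite (perm_catCA [:: delta *: e j] [:: u]).
    have bswap u : ball_seq delta m (u :: t) ->
        ball_seq delta m.+1 [:: u, delta *: e j & t].
      move=> /(ball_seq_cons (ed j)); apply: ball_seq_perm.
      by rewrite (perm_catCA [:: delta *: e j] [:: u]).
    by rewrite !swap; apply: addphi; exact: bswap.
  by move=> t tb; apply: bndphi; exact: ball_seq_cons.
rewrite (le_trans (ler_distD (\sum_j h ord0 j / delta * phi (delta *: e j :: hs)) _ _))//.
by rewrite mulrDl lerD.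
Qed.

End Stability.

(** * Polarization: from a symmetric multilinear form to a polynomial *)

Section HomogeneousPolynomial.
Context {R : realType} {d : nat}.
Local Notation V := 'rV[R]_d.+1.
Local Notation e i := (delta_mx ord0 i : V).

(* The polynomial whose polarization is the multilinear form [mlin delta _ phi]. *)
Fixpoint diag_poly (delta : R) m (phi : seq V -> R) : V -> R :=
  if m is m'.+1 then
    fun x => m%:R^-1 * \sum_j delta^-1 *
      (x ord0 j * diag_poly delta m' (fun t => phi (delta *: e j :: t)) x)
  else cst (phi [::]).

Lemma diag_poly_degree delta m phi :
  poly_of_degree_lt m.+1 (diag_poly delta m phi).
Proof.
elim: m phi => [|m IH] phi; first exact: poly_of_degree_lt_cst.
apply/poly_of_degree_ltZ/poly_of_degree_lt_sum => j; apply: poly_of_degree_ltZ.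
have := poly_of_degree_lt_coord 1%:M j (IH (fun t => phi (delta *: e j :: t))).
by congr (poly_of_degree_lt _ _); apply/funext => x; rewrite mulmx1.
Qed.

Lemma mlin_swap (delta : R) (h k : V) hs phi : symmetric_fun phi ->
  mlin delta (h :: k :: hs) phi = mlin delta (k :: h :: hs) phi.
Proof.
move=> sym /=; under eq_bigr do rewrite mulr_sumr.
rewrite exchange_big /=; apply: eq_bigr => i _; rewrite mulr_sumr.
apply: eq_bigr => j _; rewrite !mulrA [_ / _ * _ / _]mulrC !mulrA.
have -> : (fun t => phi [:: delta *: e j, delta *: e i & t]) =
          (fun t => phi [:: delta *: e i, delta *: e j & t]).
  apply/funext => t; apply: sym.
  by rewrite (perm_catCA [:: delta *: e j] [:: delta *: e i]).
by congr (_ * _); ring.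
Qed.

Lemma mlin_front (delta : R) (hs : seq V) i phi : symmetric_fun phi -> (i < size hs)%N ->
  mlin delta (nth 0 hs i :: take i hs ++ drop i.+1 hs) phi = mlin delta hs phi.
Proof.
elim: hs i phi => //= h hs IH [|i] phi sym /=; first by rewrite drop0.
rewrite ltnS => ihs; rewrite -[LHS]/(mlin delta (_ :: h :: _) phi) mlin_swap//=.
apply: eq_bigr => j _; congr (_ * _).
by apply: (IH i (fun t => phi (delta *: e j :: t))) => //; exact: symmetric_fun_cons.
Qed.

Lemma diag_poly_annihilated delta m phi :
  annihilated m.+1 (diag_poly delta m phi).
Proof.
by have [q mq ->] := diag_poly_degree delta m phi; exact: poly_fun_annihilated.
Qed.

(** [diag_poly] is the form on the diagonal divided by m!. In the Leibniz rule the full difference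
    of the lower factor vanishes, and the term in which the i-th step meets the coordinate is the
    form with that step in front. By symmetry all these terms are equal, and their number cancels
    the factor [m%:R^-1]. *)
Lemma mdiff_diag_poly delta hs phi x : symmetric_fun phi ->
  mdiff hs (diag_poly delta (size hs) phi) x = mlin delta hs phi.
Proof.
move: {2}(size hs) (erefl (size hs)) => m; elim: m hs phi x => [[]//|m IH] hs phi x shs sym.
rewrite shs /= mdiffZ mdiff_sum.
have -> : mlin delta hs phi = m.+1%:R^-1 * \sum_(i < size hs) mlin delta hs phi.
  by rewrite sumr_const card_ord shs -[X in _ * X]mulr_natl mulKf ?pnatr_eq0.
congr (_ * _).
under eq_bigr => j _.
  rewrite mdiffZ mdiff_linear_mul; last by move=> y z; rewrite mxE.
  rewrite diag_poly_annihilated// mulr0 add0r mulr_sumr.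
  over.
rewrite exchange_big /=; apply: eq_bigr => i _.
rewrite -(mlin_front delta sym (ltn_ord i)) /=; apply: eq_bigr => j _.
rewrite mulrA (mulrC _^-1); congr (_ * _).
have si : size (take i hs ++ drop i.+1 hs) = m.
  have li := ltn_ord i; rewrite size_cat size_take size_drop li.
  by move: shs li; move: (size hs) (nat_of_ord i) => ? ? ->; lia.
rewrite -{1}si; apply: IH => //; exact: symmetric_fun_cons.
Qed.

End HomogeneousPolynomial.

(** * Abstract sizes of functions, and the bound on mixed differences *)

Section Gauge.
Context {R : realType} {d : nat}.
Local Notation V := 'rV[R]_d.+1.
Implicit Types (K : set V) (f g : V -> R) (h x : V) (hs : seq V).

Definition cube (t : R) : set V := [set x | `|x| <= t].

(* [B K g c] reads: the size of [g] on [K] is at most [c].  The size is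
   quantified through its upper bounds so that for finite p it can be an upper
   integral, which needs no measurability; [mfn] is the class of measurable
   functions, needed only for the Poincare inequality at scale [s]. *)
Record gauge (kappa C1 s : R) (phi psi : R -> R) (mfn : set (V -> R))
    (B : set V -> (V -> R) -> R -> Prop) : Prop := Gauge {
  gauge_mono : forall K K' g g' c, K `<=` K' ->
    (forall x, K x -> `|g x| <= `|g' x|) -> B K' g' c -> B K g c;
  gauge0 : forall K, B K (cst 0) 0;
  gaugeD : forall K g g' c c', B K g c -> B K g' c' ->
    B K (fun x => g x + g' x) (kappa * (c + c'));
  gaugeU : forall K K' g c c', B K g c -> B K' g c' -> B (K `|` K') g (c + c');
  gauge_shift : forall K g c h, B K g c ->
    B [set x | K (x + h)] (fun x => g (x + h)) c;
  gaugeZ : forall K g c a, B K g c -> B K (fun x => a * g x) (psi a * c);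
  gauge1 : B (cube s) (cst 1) 1;
  gauge_cst_le : forall a c, B (cube s) (cst a) c -> `|a| <= phi c;
  gauge_bounded : forall t, exists c, B (cube t) (cst 1) c;
  gauge_poincare : forall g c, mfn g ->
    (forall h, `|h| <= 2 * s -> B (cube s) (fdiff h g) c) ->
    exists a, B (cube s) (fun x => g x - a) (C1 * (c + 1));
  gauge_mfn_fdiff : forall g h, mfn g -> mfn (fdiff h g);
  gauge_mfnB : forall g n P, mfn g -> poly_of_degree_lt n P ->
    mfn (fun x => g x - P x) }.

Section GaugeTheory.
Variables (kappa C1 s : R) (phi psi : R -> R).
Local Notation is_gauge mfn B := (gauge kappa C1 s phi psi mfn B).

Fixpoint sum_const n c := if n is m.+1 then kappa * (c + sum_const m c) else 0.

Lemma gauge_sum mfn B (I : eqType) (l : seq I) K (F : I -> V -> R) c :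
  is_gauge mfn B -> {in l, forall i, B K (F i) c} ->
  B K (fun x => \sum_(i <- l) F i x) (sum_const (size l) c).
Proof.
move=> gB; elim: l => [_|i l IH Fl] /=.
  rewrite (_ : (fun _ => _) = cst 0); first exact: (gauge0 gB).
  by apply/funext => x; rewrite big_nil.
rewrite (_ : (fun _ => _) = (fun x => F i x + \sum_(j <- l) F j x)); last first.
  by apply/funext => x; rewrite big_cons.
apply: (gaugeD gB); first by apply: Fl; rewrite mem_head.
by apply: IH => j jl; apply: Fl; rewrite inE jl orbT.
Qed.

Lemma gaugeN mfn B K g c : is_gauge mfn B -> B K g c -> B K (fun x => - g x) c.
Proof.
by move=> gB; apply: (gauge_mono gB) => // x _; rewrite normrN.
Qed.

Lemma gaugeB mfn B K g g' c c' : is_gauge mfn B -> B K g c -> B K g' c' ->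
  B K (fun x => g x - g' x) (kappa * (c + c')).
Proof. by move=> gB ? ?; apply: (gaugeD gB) => //; exact: (gaugeN gB). Qed.

Lemma gauge_cst mfn B a c : is_gauge mfn B -> `|a| <= c ->
  B (cube s) (cst a) (psi c).
Proof.
move=> gB ac; have := gaugeZ gB c (gauge1 gB); rewrite mulr1.
apply: (gauge_mono gB) => // x _ /=; rewrite mulr1.
by rewrite (le_trans ac)// ler_norm.
Qed.

Fixpoint mdiff_const n c :=
  if n is m.+1 then kappa * (mdiff_const m c + mdiff_const m c) else c.

(** A crude bound by the size of [g] itself. It only supplies the finiteness that the stability
    argument requires. *)
Lemma gauge_mdiff mfn B hs g t delta c : is_gauge mfn B -> 0 <= delta ->
  {in hs, forall h, `|h| <= delta} -> B (cube (t + delta *+ size hs)) g c ->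
  B (cube t) (mdiff hs g) (mdiff_const (size hs) c).
Proof.
move=> gB delta0; elim: hs t => [|h hs IH] t hsd Bg /=.
  by rewrite mulr0n addr0 in Bg.
have IHt : B (cube (t + delta)) (mdiff hs g) (mdiff_const (size hs) c).
  apply: IH; first by move=> k khs; rewrite hsd// inE khs orbT.
  by rewrite -addrA -mulrS.
apply: (gaugeB gB).
  apply: (gauge_mono gB _ _ (gauge_shift gB h IHt)) => // x /= xt.
  by rewrite /cube /= (le_trans (ler_normD _ _))// lerD// hsd// mem_head.
by apply: (gauge_mono gB _ _ IHt) => // x /= xt; rewrite /cube /= (le_trans xt)// lerDl.
Qed.

(** With r steps of norm at most [delta], the 2^r terms have base shifts and steps of norm at most r
    delta. The points involved have norm at most s + r delta + r^2 delta <= (r + 1)^2 delta, so they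
    lie in [cube eta]. *)
Lemma gauge_kemperman mfn B Omega f (eta delta : R) hs : is_gauge mfn B ->
  0 <= delta -> delta * (size hs).+1%:R ^+ 2 <= eta -> s <= delta ->
  cube eta `<=` Omega -> {in hs, forall h, `|h| <= delta} ->
  (forall h, B (difference_domain Omega (size hs) h)
               (finite_difference (size hs) h f) 1) ->
  B (cube s) (mdiff hs f) (sum_const (2 ^ size hs)%N 1).
Proof.
move=> gB delta0 deta sd cubeO hsd Bf; set r := size hs.
have len : size (signed_sums (kemperman_list hs)) = (2 ^ r)%N.
  by rewrite size_signed_sums size_mkseq.
rewrite -len (_ : mdiff hs f = (fun x => mdiff hs f x))//.
under eq_fun do rewrite kemperman.
have sum_le (F : V * V -> V) : (forall p, p \in kemperman_list hs -> `|F p| <= delta) ->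
    \sum_(p <- kemperman_list hs) `|F p| <= delta * r%:R.
  move=> Fd; rewrite big_seq (le_trans (ler_sum _ Fd))// -big_seq big_const_seq.
  by rewrite count_predT size_mkseq iter_addr_0 mulr_natr.
apply: (gauge_sum gB) => t tl.
have [t1 t2 t3] := signed_sums_le (@normr0 _ _) (@normr_ge0 _ _) (@ler_normD _ _) tl.
have {}t2 : `|t.2.1| <= delta * r%:R.
  rewrite (le_trans t2)//; apply: sum_le => p /mapP[i]; rewrite mem_iota => /andP[_ ir] ->.
  by rewrite hsd// mem_nth.
have {}t3 : `|t.2.2| <= delta * r%:R.
  rewrite (le_trans t3)//; apply: sum_le => p /mapP[i]; rewrite mem_iota => /andP[_ ir] -> /=.
  rewrite normrN normrZ normfV normr_nat -[leRHS]mul1r ler_pM//.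
    by rewrite invf_le1 ?ltr0n// ler1n.
  by rewrite hsd// mem_nth.
apply: (gauge_mono gB _ _ (gauge_shift gB t.2.1 (Bf t.2.2))) => [x /= xs j jr|x _].
  apply: cubeO; rewrite /cube /=.
  rewrite (le_trans (ler_normD _ _))//.
  rewrite (le_trans _ deta)// normrMn -/r.
  have jr' : `|t.2.2| *+ j <= delta * r%:R * r%:R.
    by rewrite -[leLHS]mulr_natr ler_pM// ler_nat.
  have xs' : `|x| <= s by [].
  have dr : 0 <= delta * r%:R by rewrite mulr_ge0.
  have := ler_normD x t.2.1; rewrite -natr1 mulrC expr2; lra.
by rewrite !normrM normrX normrN1 expr1n mul1r t1 mul1r.
Qed.

End GaugeTheory.
End Gauge.

(** * Whitney's inequality for an abstract size *)

Section GaugeWhitney.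
Context {R : realType} {d : nat}.
Local Notation V := 'rV[R]_d.+1.
Implicit Types (K : set V) (f g : V -> R) (h x : V) (hs : seq V).
Variables (kappa C1 s : R) (phi psi : R -> R).
Hypothesis s_gt0 : 0 < s.
Local Notation is_gauge mfn B := (gauge kappa C1 s phi psi mfn B).

(* Averaging replaces each [m]-fold difference of [g] by a constant; these
   constants are symmetric and nearly additive in each step, hence close to a
   symmetric multilinear form, which is the polarization of a polynomial. *)
Lemma gauge_descend m C0 : exists C, forall mfn (B : set V -> (V -> R) -> R -> Prop) g c1,
  is_gauge mfn B -> mfn g ->
  (forall hs, ball_seq (2 * s) m.+1 hs -> B (cube s) (mdiff hs g) C0) ->
  (forall hs, ball_seq (2 * s) m hs -> B (cube s) (mdiff hs g) c1) ->
  exists2 Q, poly_of_degree_lt m.+1 Q & forall hs, ball_seq (2 * s) m hs ->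
    B (cube s) (mdiff hs (fun x => g x - Q x)) C.
Proof.
have s20 : 0 < 2 * s by rewrite mulr_gt0.
have [C C_ge0 stable] := @multiadditive_stable R d (2 * s) m s20.
(* [C2] is the Poincare bound for the distance to a constant; [C3] is the size of the four-term sum
   that gives near additivity below. *)
pose C2 := C1 * (C0 + 1).
pose C3 := kappa * (kappa * (C2 + C2) + kappa * (C0 + C2)).
exists (kappa * (C2 + psi (C * `|phi C3|))) => mfn B g c1 gB mg diffS diffm.
(* The constant is chosen from the difference as a function, not from its list of steps. Permuted
   lists give the same function, so [F] is exactly symmetric. *)
pose avg P : R := xget 0 [set a | B (cube s) (fun x => P x - a) C2].
pose F hs := avg (mdiff hs g).
have mfn_mdiff hs : mfn (mdiff hs g).
  by elim: hs => //= h hs; exact: (gauge_mfn_fdiff gB).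
have FP hs : ball_seq (2 * s) m hs ->
    B (cube s) (fun x => mdiff hs g x - F hs) C2.
  move=> hsb; apply: (xgetPex 0 (P := [set a | B (cube s) (fun x => mdiff hs g x - a) C2])).
  apply: (gauge_poincare gB) => // h hs2.
  by apply: (diffS (h :: hs)); exact: ball_seq_cons.
have Fsym : symmetric_fun F by move=> hs ks hk; rewrite /F (mdiff_perm _ hk).
have Fadd h k hs : ball_seq (2 * s) m (h :: hs) -> ball_seq (2 * s) m (k :: hs) ->
     ball_seq (2 * s) m (h + k :: hs) ->
    `|F (h + k :: hs) - F (h :: hs) - F (k :: hs)| <= `|phi C3|.
  move=> hb kb hkb; rewrite (le_trans _ (ler_norm _))//.
  apply: (gauge_cst_le gB).
  have kd : `|k| <= 2 * s by apply: kb.2; rewrite mem_head.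
  (* With D the difference over [hs], the increment of D for h + k is the sum of those for h and for
     k and of the mixed one. In this combination the functions cancel and the constant F(h + k) -
     F(h) - F(k) remains. *)
  have := gaugeD gB (gaugeD gB (FP _ hb) (FP _ kb))
    (gaugeB gB (diffS _ (ball_seq_cons kd hb)) (FP _ hkb)).
  congr (B _ _ _); apply/funext => x /=; rewrite /fdiff.
  by rewrite (addrA x h) (addrAC x k h); ring.
have Fbnd hs : ball_seq (2 * s) m hs -> `|F hs| <= phi (kappa * (c1 + C2)).
  move=> hsb; apply: (gauge_cst_le gB).
  have := gaugeB gB (diffm _ hsb) (FP _ hsb).
  by congr (B _ _ _); apply/funext => x /=; ring.
exists (diag_poly (2 * s) m F); first exact: diag_poly_degree.
move=> hs hsb; have Fhs := stable F _ _ (normr_ge0 _) Fsym Fadd Fbnd hs hsb.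
have := gaugeD gB (FP _ hsb) (gauge_cst gB Fhs).
congr (B _ _ _); apply/funext => x /=; rewrite mdiffB -hsb.1 mdiff_diag_poly//.
by ring.
Qed.

Lemma gauge_poly_bounded mfn B n P (t : R) : is_gauge mfn B -> 0 <= t ->
  poly_of_degree_lt n P -> exists c, B (cube t : set V) P c.
Proof.
move=> gB t0 [q nq ->].
have [M qM] : exists M : R, forall x, `|x| <= t -> `|poly_fun q x| <= M.
  apply: (poly_fun_ind (P := fun _ f => exists M : R, forall x, `|x| <= t -> `|f x| <= M)) nq.
  - by move=> _; exists 0 => x _; rewrite normr0.
  - by move=> _ c; exists `|c|.
  - move=> _ f g [M fM] [N gN]; exists (M + N) => x xt.
    by rewrite (le_trans (ler_normD _ _))// lerD ?fM ?gN.
  - move=> _ i f [M fM]; exists (t * M) => x xt.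
    by rewrite normrM ler_pM ?fM// (le_trans (coord_le_norm _ _)).
  - by move=> _ f c [M fM]; exists (`|c| * M) => x xt; rewrite normrM ler_wpM2l ?fM.
have [c Bc] := gauge_bounded gB t; exists (psi M * c).
apply: (gauge_mono gB _ _ (gaugeZ gB M Bc)) => // x xt /=.
by rewrite mulr1 (le_trans (qM _ xt))// ler_norm.
Qed.

(** [r] stays fixed while [m] decreases: the larger cube leaves room for the crude bounds on
    differences of order below r, and finiteness there survives each subtraction of a polynomial. *)
Lemma gauge_whitney_cube r m C0 : (m <= r)%N ->
  exists C, forall mfn (B : set V -> (V -> R) -> R -> Prop) g c,
  is_gauge mfn B -> mfn g -> B (cube (s + (2 * s) *+ r)) g c ->
  (forall hs, ball_seq (2 * s) m hs -> B (cube s) (mdiff hs g) C0) ->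
  exists2 Q, poly_of_degree_lt m Q & B (cube s) (fun x => g x - Q x) C.
Proof.
elim: m C0 => [|m IH] C0 mr.
  exists C0 => mfn B g c gB mg _ B0; exists (cst 0).
    exact: poly_of_degree_lt0.
  have /= B1 := B0 [::]; apply: (gauge_mono gB _ _ (B1 _)) => //.
  by move=> x _; rewrite subr0.
have [C' descend] := gauge_descend m C0.
have [C cube_m] := IH C' (ltnW mr); exists C => mfn B g c gB mg Bg B0.
have s20 : 0 <= 2 * s by rewrite mulr_ge0// ltW.
have big0 : 0 <= s + (2 * s) *+ r by rewrite addr_ge0 ?mulrn_wge0// ltW.
have [Q1 dQ1 BQ1] : exists2 Q, poly_of_degree_lt m.+1 Q & forall hs, ball_seq (2 * s) m hs ->
    B (cube s) (mdiff hs (fun x => g x - Q x)) C'.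
  apply: (descend mfn B g (mdiff_const kappa m c)) => // hs [shs hsd]; rewrite -shs.
  apply: (gauge_mdiff gB s20 hsd); apply: (gauge_mono gB _ _ Bg) => // x.
  rewrite /cube /= => /le_trans; apply; by rewrite lerD2l ler_wpMn2l// shs ltnW.
have [c1 Bc1] := gauge_poly_bounded gB big0 dQ1.
have [Q2 dQ2 BQ2] := cube_m mfn B _ _ gB (gauge_mfnB gB mg dQ1) (gaugeB gB Bg Bc1) BQ1.
exists (fun x => Q1 x + Q2 x).
  exact: poly_of_degree_ltD dQ1 (poly_of_degree_ltW (leqnSn m) dQ2).
by move: BQ2; congr (B _ _ _); apply/funext => x; ring.
Qed.

Lemma gauge_cover mfn B (I : eqType) (l : seq I) K (F : I -> set V) g c0 c1 :
  is_gauge mfn B -> B K g c0 -> {in l, forall i, B (F i) g c1} ->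
  B (K `|` \bigcup_(i in [set` l]) F i) g (c0 + c1 *+ size l).
Proof.
move=> gB Kg; elim: l => [_|i l IH Fl] /=.
  rewrite mulr0n addr0; apply: (gauge_mono gB _ _ Kg) => // x [//|[]//].
rewrite mulrS addrCA; apply: (gauge_mono gB _ _ (gaugeU gB (Fl i _) (IH _))) => //.
- move=> x [Kx|[j /= +] Fjx]; first by right; left.
  rewrite inE => /orP[/eqP <-|jl]; first by left.
  by right; right; exists j.
- by rewrite mem_head.
- by move=> j jl; apply: Fl; rewrite inE jl orbT.
Qed.

Lemma cube_net (rho e : R) : 0 < e -> exists l : seq V, forall x, `|x| <= rho ->
  exists2 c, c \in l & `|x - c| <= e.
Proof.
move=> e0; pose N := (Num.truncn ((rho + rho) / e)).+1.
exists [seq \row_j (e * (w j)%:R - rho) | w : {ffun 'I_d.+1 -> 'I_N}] => x xr.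
have xi i : 0 <= (x ord0 i + rho) / e <= (rho + rho) / e.
  have := le_trans (coord_le_norm x i) xr; rewrite ler_norml => /andP[lo hi].
  by rewrite divr_ge0 ?(ltW e0)//= ?ler_pM2r ?invr_gt0//; lra.
have tN i : (Num.truncn ((x ord0 i + rho) / e) < N)%N.
  by rewrite ltnS le_truncn//; case/andP: (xi i).
exists (\row_j (e * (Num.truncn ((x ord0 j + rho) / e))%:R - rho)).
  apply/mapP; exists [ffun i => Ordinal (tN i)]; first by rewrite mem_enum.
  by apply/rowP => i; rewrite !mxE ffunE.
apply: norm_le_coord => [|i]; first exact: ltW.
rewrite !mxE; have /andP[x0 _] := xi i.
have /andP[] := truncn_itv x0; rewrite ler_pdivlMr// ltr_pdivrMr//.
rewrite -natr1 => lo hi; rewrite ger0_norm; lra.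
Qed.

(** Star-shapedness by segments, free of closed hulls. *)
Definition star_at (Omega : set V) (K : set V) := forall x y (t : R),
  Omega x -> K y -> 0 <= t <= 1 -> Omega ((1 - t) *: x + t *: y).

(** For x within s/2 of c, the point x - (j/r) c is the convex combination (1 - j/r) x + (j/r) (x -
    c), with x - c in [cube s]; so it stays in Omega, and for j >= 1 it is closer to the origin.
    Each round enlarges the radius by (s/2)/r, so the number of rounds and of cells depends on rho,
    s, r and d alone. *)
Lemma gauge_extend r rho C0 : (0 < r)%N -> exists C,
  forall mfn (B : set V -> (V -> R) -> R -> Prop) Omega g,
  is_gauge mfn B -> star_at Omega (cube s) -> Omega `<=` cube rho ->
  (forall h, B (difference_domain Omega r h) (finite_difference r h g) 1) ->
  B (cube s) g C0 -> B Omega g C.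
Proof.
(* [b] is a common bound for the binomial coefficients. *)
have s0 := s_gt0; move=> r0; pose b := (\sum_(k < r.+1) 'C(r, k))%N.
have rp : 0 < r%:R :> R by rewrite ltr0n.
have [l lP] := @cube_net rho (s / 2) (divr_gt0 s_gt0 (ltr0Sn R 1)).
suff step n : exists C, forall mfn (B : set V -> (V -> R) -> R -> Prop) Omega g,
  is_gauge mfn B -> star_at Omega (cube s) -> Omega `<=` cube rho ->
  (forall h, B (difference_domain Omega r h) (finite_difference r h g) 1) ->
  B (cube s) g C0 -> B (Omega `&` cube (s + s / 2 / r%:R * n%:R)) g C.
  have [C HC] := step (Num.truncn (rho / (s / 2 / r%:R))).+1.
  exists C => mfn B Omega g gB star Orho Bd B0.
  apply: (gauge_mono gB _ _ (HC mfn B Omega g gB star Orho Bd B0)) => // x Ox.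
  split=> //; rewrite /cube /= (le_trans (Orho x Ox))//.
  have q0 : 0 < s / 2 / r%:R by rewrite !divr_gt0.
  have [rho0|rho0] := leP 0 rho; last first.
    by rewrite (le_trans (ltW rho0))// addr_ge0// ?(ltW s_gt0)// mulr_ge0// ltW.
  have /andP[_] := truncn_itv (divr_ge0 rho0 (ltW q0)).
  by rewrite ltr_pdivrMr// => /ltW; rewrite mulrC => /le_trans; apply; rewrite lerDr ltW.
elim: n => [|n [Cn IH]].
  exists C0 => mfn B Omega g gB star Orho Bd B0.
  by rewrite mulr0 addr0; apply: (gauge_mono gB _ _ B0) => // x [].
pose t := s + s / 2 / r%:R * n%:R; pose t' := s + s / 2 / r%:R * n.+1%:R.
have tt' : t' = t + s / 2 / r%:R by rewrite /t' /t -natr1; ring.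
have st : s <= t by rewrite lerDl !mulr_ge0 ?invr_ge0// ltW.
pose Ccell := kappa * (1 + sum_const kappa r (psi b%:R * Cn)).
exists (Cn + Ccell *+ size l) => mfn B Omega g gB star Orho Bd B0.
have Bn := IH mfn B Omega g gB star Orho Bd B0.
pose cell c := Omega `&` cube t' `&` [set x | `|x - c| <= s / 2].
have moved c x j : cell c x -> (j < r)%N ->
    (Omega `&` cube t) (x + (- (r%:R^-1 *: c)) *+ j.+1).
  move=> [[Ox xt'] /= xc] jr; have s2s : s / 2 <= s by lra.
  have {}xt' : `|x| <= t' := xt'; pose u : R := j.+1%:R / r%:R.
  have u1 : u <= 1 by rewrite ler_pdivrMr// mul1r ler_nat.
  have ri0 : 0 <= r%:R^-1 :> R by rewrite invr_ge0 ltW.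
  have u0 : r%:R^-1 <= u by rewrite ler_peMl// ler1n.
  have u00 : 0 <= u by rewrite (le_trans _ u0)// invr_ge0 ltW.
  have -> : x + - (r%:R^-1 *: c) *+ j.+1 = (1 - u) *: x + u *: (x - c).
    rewrite scalerBl scale1r scalerBr addrA subrK mulNrn -scaler_nat scalerA.
    by rewrite /u.
  split.
    apply: star => //; last by rewrite u00.
    by apply: (le_trans xc).
  have u1' : 0 <= 1 - u by rewrite subr_ge0.
  have n1 : `|(1 - u) *: x| = (1 - u) * `|x| by rewrite normrZ ger0_norm.
  have n2 : `|u *: (x - c)| = u * `|x - c| by rewrite normrZ ger0_norm.
  rewrite /cube /= (le_trans (ler_normD _ _))// n1 n2.
  have xt : `|x| <= t + s / 2 / r%:R by rewrite -tt'.
  have h1 : (1 - u) * `|x| <= (1 - u) * (t + s / 2 / r%:R) by rewrite ler_wpM2l.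
  have h2 : u * `|x - c| <= u * (s / 2) by rewrite ler_wpM2l.
  (* From u >= 1/r and t >= s: moving the fraction u towards x - c gains at least the width of one
     round. *)
  have h3 : r%:R^-1 * (s / 2) <= u * (t - s / 2).
    by apply: ler_pM => //; lra.
  have h4 : 0 <= u * (s / 2 / r%:R) by rewrite mulr_ge0// !divr_ge0// ltW.
  lra.
have Bcell c : B (cell c) g Ccell.
  pose h := - (r%:R^-1 *: c).
  have Bdiff : B (cell c) (finite_difference r h g) 1.
    apply: (gauge_mono gB _ _ (Bd h)) => // x cx [_|j jr].
      by rewrite mulr0n addr0; case: cx => -[].
    by have [] := moved c x j cx jr.
  have Bsum : B (cell c) (fun x => \sum_(j <- enum 'I_r)
      ((-1) ^+ (r + j.+1) * 'C(r, j.+1)%:R * g (x + h *+ j.+1)))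
      (sum_const kappa (size (enum 'I_r)) (psi b%:R * Cn)).
    apply: (gauge_sum gB) => j _.
    apply: (gauge_mono gB _ _ (gauge_shift gB (h *+ j.+1) (gaugeZ gB b%:R Bn))).
      by move=> x cx; exact: moved.
    move=> x _; rewrite !normrM normrX normrN1 expr1n mul1r !normr_nat.
    rewrite ler_wpM2r// ler_nat.
    have jr : (j.+1 < r.+1)%N by rewrite ltnS.
    by rewrite /b (bigD1 (Ordinal jr))//= leq_addr.
  rewrite size_enum_ord in Bsum.
  apply: (gauge_mono gB _ _ (gaugeB gB Bdiff Bsum)) => // x _.
  rewrite big_enum /= /finite_difference big_ord_recl /= bin0 mulr1 mulr0n addr0 addn0.
  under [X in _ + X - _]eq_bigr => j _ do rewrite /bump /= add1n.
  by rewrite addrK normrM normrX normrN1 expr1n mul1r.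
have lB : {in l, forall c, B (cell c) g Ccell} by [].
apply: (gauge_mono gB _ _ (gauge_cover gB Bn lB)) => // x [Ox xt'].
have [c cl xc] := lP x (Orho x Ox).
by right; exists c.
Qed.

(** [C] is chosen before [c]: the size of [f] on the cube need only be finite. Subtracting [Q]
    leaves the r-th differences unchanged, so the extension applies to the remainder. *)
Theorem gauge_whitney r (eta rho : R) : (0 < r)%N ->
  2 * s * r.+1%:R ^+ 2 <= eta -> exists C,
  forall mfn (B : set V -> (V -> R) -> R -> Prop) Omega f c,
  is_gauge mfn B -> mfn f -> cube eta `<=` Omega ->
  star_at Omega (cube eta) -> Omega `<=` cube rho ->
  (forall h, B (difference_domain Omega r h) (finite_difference r h f) 1) ->
  B (cube eta) f c ->
  exists2 Q, poly_of_degree_lt r Q & B Omega (fun x => f x - Q x) C.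
Proof.
move=> r0 s_eta; have s0 := s_gt0; have s20 : 0 <= 2 * s by rewrite mulr_ge0// ltW.
have [C' cube_case] := gauge_whitney_cube (sum_const kappa (2 ^ r)%N 1) (leqnn r).
have [C extend] := gauge_extend rho C' r0.
exists C => mfn B Omega f c gB mf etaO star Orho Bd Bf.
have eta2 : 2 * s * r.+1%:R <= eta.
  rewrite (le_trans _ s_eta)// expr2 mulrA ler_peMr ?ler1n// mulr_ge0//.
have s_le : s + 2 * s *+ r <= eta.
  by rewrite (le_trans _ eta2)// -[X in s + X]mulr_natr -[r.+1%:R]natr1; lra.
have s_eta' : s <= eta by rewrite (le_trans _ s_le)// lerDl mulrn_wge0.
have cubeS t : t <= eta -> cube t `<=` (cube eta : set V).
  by move=> te x xt; exact: le_trans xt te.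
have [Q dQ BQ] : exists2 Q, poly_of_degree_lt r Q & B (cube s) (fun x => f x - Q x) C'.
  apply: (cube_case mfn B f c gB mf) => [|hs hsb].
    by apply: (gauge_mono gB _ _ Bf) => //; exact: cubeS.
  rewrite -{1}hsb.1; apply: (gauge_kemperman gB s20 _ _ etaO hsb.2) => //.
  - by rewrite hsb.1.
  - by lra.
  - by move=> h; rewrite hsb.1; exact: Bd.
exists Q => //; apply: (extend mfn) => //.
- by move=> x y t Ox ys; apply: star => //; exact: cubeS ys.
- move=> h; apply: (gauge_mono gB _ _ (Bd h)) => // x _.
  have [q rq ->] := dQ.
  rewrite !finite_difference_mdiff mdiffB (poly_fun_annihilated rq) ?subr0//.
  by rewrite size_nseq.
Qed.

End GaugeWhitney.

(** * Lebesgue measure: measurable sets, scaling and translation *)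

Section LebesgueMeasurability.
Context {R : realType} {d : nat}.
Local Notation V := 'rV[R]_d.+1.
Local Notation T := (@lebesgue_type R d).
Local Notation mu := (@lebesgue_outer R d).
Local Notation lam := (@lebesgue_rV R d).

Definition set_coord (x : V) i (t : R) : V :=
  \row_j (if j == i then t else x ord0 j).

(** The hyperplane cuts each box of a cover into two half-open boxes whose volumes add up exactly,
    an empty one having volume 0. *)
Lemma measurable_halfspace i (t : R) :
  measurable ([set x | x ord0 i <= t] : set T).
Proof.
apply: le_caratheodory_measurable => X; apply: le_ereal_inf_tmp => _ [c Xc <-].
pose c1 k := ((c k).1, set_coord (c k).2 i (Num.min ((c k).2 ord0 i) t)).
pose c2 k := (set_coord (c k).1 i (Num.max ((c k).1 ord0 i) t), (c k).2).
have c12 k : box_vol (c k) = (box_vol (c1 k) + box_vol (c2 k))%E.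
  pose F (e : V * V) j := Num.max (e.2 ord0 j - e.1 ord0 j) 0.
  have E e : box_vol e = (F e i * \prod_(j | j != i) F e j)%:E.
    by rewrite /box_vol (bigD1 i).
  rewrite !E -EFinD; congr (_%:E).
  have e1 : \prod_(j | j != i) F (c1 k) j = \prod_(j | j != i) F (c k) j.
    by apply: eq_bigr => j ji; rewrite /F !mxE (negbTE ji).
  have e2 : \prod_(j | j != i) F (c2 k) j = \prod_(j | j != i) F (c k) j.
    by apply: eq_bigr => j ji; rewrite /F !mxE (negbTE ji).
  rewrite e1 e2.
  rewrite -mulrDl; congr (_ * _).
  rewrite /F /= !mxE eqxx; move: ((c k).1 ord0 i) ((c k).2 ord0 i) => a b.
  rewrite !maxEle !minEle.
  by case: (leP b t); case: (leP a t) => ? ?; repeat case: ifP => ?; lra.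
rewrite (eq_eseriesr (fun k _ => c12 k)) nneseriesD; last 2 first.
- by move=> k _ _; exact: box_vol_ge0.
- by move=> k _ _; exact: box_vol_ge0.
apply: leeD; apply: ereal_inf_lbound; [exists c1 => //|exists c2 => //].
- move=> x [/Xc [k _ xk] /= xt]; exists k => // j; rewrite /= in_itv /=.
  have := xk j; rewrite in_itv /= => /andP[-> xj]; rewrite mxE.
  by case: eqP => // ji; rewrite le_min -ji xj/= ji.
- move=> x [/Xc [k _ xk] /= /negP]; rewrite -ltNge => xt.
  exists k => // j; rewrite /= in_itv /=.
  have := xk j; rewrite in_itv /= => /andP[xj ->]; rewrite mxE andbT.
  by case: eqP => // ji; rewrite gt_max -ji xj/= ji.
Qed.

Lemma measurable_fun_lower_rays d' (T' : measurableType d') (f : T' -> R) :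
  (forall t, measurable [set x | f x <= t]) -> measurable_fun setT f.
Proof.
move=> mf; apply: (measurability _ (RGenOInfty.measurableE R)) => _ [_ [t ->] <-].
rewrite setTI (_ : _ @^-1` _ = ~` [set x | f x <= t]); first exact: measurableC.
apply/seteqP; split => x /=; rewrite in_itv/= andbT.
  by rewrite ltNge => /negP.
by move/negP; rewrite -ltNge.
Qed.

Lemma measurable_coord i : measurable_fun setT (fun x : T => x ord0 i).
Proof. by apply: measurable_fun_lower_rays => t; exact: measurable_halfspace. Qed.

Lemma measurable_box c : measurable (box c : set T).
Proof.
rewrite (_ : box c = \bigcap_(i in [set: 'I_d.+1])
    ((fun x : T => x ord0 i) @^-1` `](c.1 ord0 i), (c.2 ord0 i)])); last first.
  by apply/seteqP; split => x /= xc i; [move=> _; exact: xc|exact: xc].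
apply: fin_bigcap_measurable => // i _.
by rewrite -[X in measurable X]setTI; apply: measurable_coord.
Qed.

Lemma measurable_affine_coord (A : 'M[R]_d.+1) (b : V) j :
  measurable_fun setT (fun x : T => affine_map A b x ord0 j).
Proof.
rewrite (_ : (fun _ => _) = (fun x : T => \sum_i x ord0 i * A i j + b ord0 j)); last first.
  by apply/funext => x; rewrite /affine_map !mxE.
have mi i : measurable_fun setT (fun x : T => x ord0 i * A i j).
  exact: measurable_funM (measurable_coord i) (measurable_cst (A i j)).
exact: measurable_funD (measurable_sum _ mi) (measurable_cst (b ord0 j)).
Qed.

Lemma measurable_preimage_cube d' (T' : measurableType d') (F : T' -> V) (t : R) :
  (forall i, measurable_fun setT (fun x => F x ord0 i)) ->
  measurable [set x | `|F x| <= t].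
Proof.
move=> mF; have [t0|t0] := ltP t 0.
  rewrite (_ : [set x | _] = set0)//; apply/seteqP; split => x //=.
  by move=> /le_lt_trans /(_ t0); rewrite ltNge normr_ge0.
rewrite (_ : [set x | _] = \bigcap_(i in [set: 'I_d.+1])
    ((fun x => F x ord0 i) @^-1` `[(- t), t])); last first.
  apply/seteqP; split => x /=.
    move=> xt i _; rewrite /= in_itv/= -ler_norml.
    by rewrite (le_trans (coord_le_norm _ _)).
  move=> xt; apply: norm_le_coord => // i; rewrite ler_norml.
  by have := xt i I; rewrite /= in_itv.
apply: fin_bigcap_measurable => // i _.
by rewrite -[X in measurable X]setTI; apply: mF.
Qed.

Lemma measurable_affine_cube (A : 'M[R]_d.+1) (b : V) (t : R) :
  measurable ([set x | `|affine_map A b x| <= t] : set T).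
Proof.
by apply: measurable_preimage_cube => i; exact: measurable_affine_coord.
Qed.

Lemma box_vol_affine (t : R) (b : V) (c : V * V) : 0 <= t ->
  box_vol (t *: c.1 + b, t *: c.2 + b) = ((t ^+ d.+1)%:E * box_vol c)%E.
Proof.
move=> t0; rewrite /box_vol -EFinM; congr (_%:E).
rewrite -[X in t ^+ X]card_ord -prodr_const -big_split /=.
apply: eq_bigr => i _; rewrite !mxE maxr_pMr// mulr0.
by congr (Num.max _ _); ring.
Qed.

Lemma lebesgue_outer_affine_le (t : R) (b : V) (A : set V) : 0 < t ->
  (mu [set (t *: x + b)%R | x in A] <= (t ^+ d.+1)%:E * mu A)%E.
Proof.
move=> t0; have td : 0 < t ^+ d.+1 by rewrite exprn_gt0.
rewrite -lee_pdivrMl//; apply: le_ereal_inf_tmp => _ [c Ac <-].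
rewrite lee_pdivrMl//.
pose c' k := (t *: (c k).1 + b, t *: (c k).2 + b).
have c'A : box_cover [set (t *: x + b)%R | x in A] c'.
  move=> _ [x /Ac [k _ xk] <-]; exists k => // i; have := xk i.
  by rewrite !in_itv /= !mxE !lerD2r !ltrD2r ler_pM2l// ltr_pM2l.
apply: le_trans (ereal_inf_lbound (ex_intro2 _ _ c' c'A erefl)) _.
rewrite -nneseriesZl; last by move=> k _; exact: box_vol_ge0.
apply: lee_nneseries => [k _ _|k _]; first exact: box_vol_ge0.
by rewrite -(box_vol_affine b (c k) (ltW t0)).
Qed.

Lemma lebesgue_outer_affine (t : R) (b : V) (A : set V) : 0 < t ->
  mu [set (t *: x + b)%R | x in A] = ((t ^+ d.+1)%:E * mu A)%E.
Proof.
move=> t0; apply/eqP; rewrite eq_le lebesgue_outer_affine_le//=.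
have td : 0 < t ^+ d.+1 by rewrite exprn_gt0.
have ti : 0 < t^-1 by rewrite invr_gt0.
rewrite -lee_pdivlMl// -exprVn.
apply: (le_trans _ (lebesgue_outer_affine_le (- (t^-1 *: b)) _ ti)).
apply: le_lebesgue_outer => x Ax /=; exists (t *: x + b); first by exists x.
by rewrite scalerDr scalerA mulVf ?gt_eqF// scale1r addrK.
Qed.

Lemma lebesgue_outer_shift (h : V) (A : set V) :
  mu [set x | A (x + h)] = mu A.
Proof.
rewrite (_ : [set x | _] = [set (1%R *: x - h)%R | x in A]); last first.
  apply/seteqP; split => [x Ax|_ [x Ax <-]] /=; last by rewrite scale1r subrK.
  by exists (x + h); rewrite // scale1r addrK.
by rewrite lebesgue_outer_affine// expr1n mul1e.
Qed.

Lemma measurable_shift (h : V) (A : set T) : measurable A ->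
  measurable ([set x | A (x + h)] : set T).
Proof.
move=> mA; suff : caratheodory_measurable mu [set x | A (x + h)] by [].
have {}mA : caratheodory_measurable mu A by [].
move=> X; have := mA [set x | X (x - h)].
rewrite -(lebesgue_outer_shift h [set x | X (x - h)]).
rewrite -(lebesgue_outer_shift h ([set x | X (x - h)] `&` A)).
rewrite -(lebesgue_outer_shift h ([set x | X (x - h)] `&` ~` A)).
rewrite (_ : [set x | [set x0 | X (x0 - h)] (x + h)] = X); last first.
  by apply/funext => x /=; rewrite addrK.
rewrite (_ : [set x | ([set x0 | X (x0 - h)] `&` A) (x + h)] = X `&` [set x | A (x + h)]); last first.
  by apply/funext => x /=; rewrite addrK.
rewrite (_ : [set x | ([set x0 | X (x0 - h)] `&` ~` A) (x + h)] = X `&` ~` [set x | A (x + h)])//.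
by apply/funext => x /=; rewrite addrK.
Qed.

Lemma measurable_fun_shift (h : V) : measurable_fun setT (fun x : T => (x + h : T)).
Proof. by move=> _ A mA; rewrite setTI; exact: measurable_shift. Qed.

Lemma ge0_integral_shift (h : V) (G : T -> \bar R) : measurable_fun setT G ->
  (forall x, (0 <= G x)%E) ->
  (\int[lam]_x G (x + h)%R = \int[lam]_x G x)%E.
Proof.
move=> mG G0.
have mh := measurable_fun_shift h.
have E := ge0_integral_pushforward mh lam measurableT mG (fun x _ => G0 x).
rewrite preimage_setT in E.
apply: etrans (esym E) _.
apply: eq_measure_integral => A mA _.
exact: lebesgue_outer_shift.
Qed.

Lemma lebesgue_outer_cube_fin (t : R) : (mu (cube t) < +oo)%E.
Proof.
pose c k : V * V := if k is 0 then (const_mx (- t - 1), const_mx t) else (0, 0).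
apply: (@le_lt_trans _ _ (\sum_(k <oo) box_vol (c k))%E).
  apply: ereal_inf_lbound; exists c => // x xt; exists 0 => // i.
  have /(le_trans (coord_le_norm x i)) : `|x| <= t by [].
  by rewrite /= in_itv/= !mxE ler_norml => /andP[? ->]; rewrite andbT; lra.
rewrite nneseries_recl//; last by move=> k _; exact: box_vol_ge0.
rewrite [X in (_ + X)%E]eseries0; last by case=> // k _ _; exact: box_vol0.
by rewrite adde0 ltry.
Qed.

Lemma lebesgue_sigma_finite : sigma_finite setT (@lebesgue_rV R d).
Proof.
exists (fun n => cube n%:R).
  apply/esym; rewrite -subTset => x _; exists (Num.truncn `|x|).+1 => //.
  by rewrite /cube /= ltW// truncnS_gt.
move=> n; split; last exact: lebesgue_outer_cube_fin.
have := measurable_affine_cube 1%:M 0 n%:R; congr (measurable _).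
by apply/funext => x; rewrite /= /affine_map mulmx1 addr0.
Qed.

HB.instance Definition _ := Measure_isSigmaFinite.Build _ T R (@lebesgue_rV R d)
  lebesgue_sigma_finite.

End LebesgueMeasurability.

(** * Modification on a null set and joint measurability *)

Section BorelVersion.
Context {R : realType} {d : nat}.
Local Notation V := 'rV[R]_d.+1.
Local Notation T := (@lebesgue_type R d).
Local Notation mu := (@lebesgue_outer R d).
Local Notation lam := (@lebesgue_rV R d).

(* Joint measurability of [(x, h) |-> g (x + h)] fails for Lebesgue measurable
   [g]; it holds after a modification on a null set. *)
Definition addition_measurable (S : set V) : Prop :=
  measurable (S : set T) /\ measurable ([set z | S (z.1 + z.2)] : set (T * T)).

Lemma measurable_coord_add i :
  measurable_fun setT (fun z : T * T => (z.1 + z.2 : V) ord0 i).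
Proof.
rewrite (_ : (fun _ => _) = (fun z : T * T => (z.1 : V) ord0 i + (z.2 : V) ord0 i)); last first.
  by apply/funext => z; rewrite mxE.
apply: measurable_funD.
- exact: (measurableT_comp (measurable_coord i) measurable_fst).
- exact: (measurableT_comp (measurable_coord i) measurable_snd).
Qed.

Lemma addition_measurable_box c : addition_measurable (box c).
Proof.
split; first exact: measurable_box.
rewrite (_ : [set z | _] = \bigcap_(i in [set: 'I_d.+1])
    ((fun z : T * T => (z.1 + z.2 : V) ord0 i) @^-1` `](c.1 ord0 i), (c.2 ord0 i)])); last first.
  by apply/seteqP; split => x /= xc i; [move=> _; exact: xc|exact: xc].
apply: fin_bigcap_measurable => // i _.
by rewrite -[X in measurable X]setTI; apply: measurable_coord_add.
Qed.

Lemma addition_measurableC S : addition_measurable S -> addition_measurable (~` S).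
Proof. by move=> [mS mS']; split; [exact: measurableC|exact: (measurableC mS')]. Qed.

Lemma addition_measurable_bigcup (I : countType) (F : I -> set V) :
  (forall i, addition_measurable (F i)) -> addition_measurable (\bigcup_i F i).
Proof.
move=> mF; split.
  by apply: countable_bigcupT_measurable => [|i]; [exact: countableP|exact: (mF i).1].
rewrite (_ : [set z | _] = \bigcup_i [set z : T * T | F i (z.1 + z.2)]).
  by apply: countable_bigcupT_measurable => [|i]; [exact: countableP|exact: (mF i).2].
by apply/seteqP; split => z [i _ Fz]; exists i.
Qed.

Lemma addition_measurable_bigcap (I : countType) (F : I -> set V) :
  (forall i, addition_measurable (F i)) -> addition_measurable (\bigcap_i F i).
Proof.
move=> mF; rewrite -(setCK (\bigcap_i _)) setC_bigcap.
apply: addition_measurableC; apply: addition_measurable_bigcup => i.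
exact: addition_measurableC.
Qed.

Lemma addition_measurableU S S' : addition_measurable S ->
  addition_measurable S' -> addition_measurable (S `|` S').
Proof. by move=> [? m] [? m']; split; [exact: measurableU|exact: (measurableU _ _ m m')]. Qed.

Lemma addition_measurableI S S' : addition_measurable S ->
  addition_measurable S' -> addition_measurable (S `&` S').
Proof. by move=> [? m] [? m']; split; [exact: measurableI|exact: (measurableI _ _ m m')]. Qed.

(** The intersection over n of covers whose volume exceeds the outer measure by at most 1/(n + 1):
    it arises from boxes by countable operations. *)
Lemma outer_hull (S : set V) : (mu S < +oo)%E ->
  exists G, [/\ addition_measurable G, S `<=` G & mu G = mu S].
Proof.
move=> Sfin; have Sf : mu S \is a fin_num by rewrite ge0_fin_numE// lebesgue_outer_ge0.
have cover n : exists c, box_cover S c /\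
    (\sum_(k <oo) box_vol (c k) <= mu S + (n.+1%:R^-1)%:E)%E.
  have n0 : 0 < n.+1%:R^-1 :> R by rewrite invr_gt0.
  have [_ [c Sc <-] /ltW ?] := lb_ereal_inf_adherent n0 Sf.
  by exists c.
have {cover}/choice [c cP] := cover.
exists (\bigcap_n \bigcup_k box (c n k)); split.
- apply: addition_measurable_bigcap => n; apply: addition_measurable_bigcup => k.
  exact: addition_measurable_box.
- by move=> x Sx n _; exact: (cP n).1.
apply/eqP; rewrite eq_le; apply/andP; split; last first.
  by apply: le_lebesgue_outer => x Sx n _; exact: (cP n).1.
apply/lee_addgt0Pr => e e0.
have [n ne] : exists n, n.+1%:R^-1 <= e.
  exists (Num.truncn e^-1); rewrite -[leRHS]invrK lef_pV2 ?posrE ?invr_gt0//.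
  by rewrite ltW// truncnS_gt.
apply: (@le_trans _ _ (mu S + (n.+1%:R^-1)%:E)%E); last by rewrite leeD2l.
apply: le_trans (cP n).2; apply: ereal_inf_lbound; exists (c n) => //.
by move=> x /(_ n I).
Qed.

(** [S'] is a hull of [S], and [N] a hull of the null set between them, so that the exceptional set
    is [addition_measurable] too. *)
Lemma measurable_approx_fin (S : set T) : measurable S -> (mu S < +oo)%E ->
  exists S' N, [/\ addition_measurable S', addition_measurable N, mu N = 0 &
    forall x, ~ N x -> S x <-> S' x].
Proof.
move=> mS Sfin; have [S' [mS' SS' muS']] := outer_hull Sfin.
have D0 : mu (S' `\` S) = 0.
  have cS : caratheodory_measurable mu S by [].
  have := cS S'; rewrite (setIidr SS') -setDE muS'.
  have : mu S \is a fin_num by rewrite ge0_fin_numE// lebesgue_outer_ge0.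
  move: (mu (S' `\` S)) (lebesgue_outer_ge0 (S' `\` S)) => [x| |]//.
    by move: (mu S) => [s| |]// x0 _ [] /eqP; rewrite addrC -subr_eq subrr => /eqP <-.
  by move: (mu S) => [s| |].
have [|N [mN DN muN]] := @outer_hull (S' `\` S); first by rewrite D0.
exists S', N; split => //; first by rewrite muN D0.
move=> x Nx; split; first exact: SS'.
by move=> S'x; apply: contrapT => Sx; exact/Nx/DN.
Qed.

Lemma null_bigcup (F : nat -> set V) : (forall n, mu (F n) = 0) ->
  mu (\bigcup_n F n) = 0.
Proof.
move=> F0; apply/eqP; rewrite eq_le lebesgue_outer_ge0 andbT.
rewrite (le_trans (lebesgue_outer_sigma_subadditive F))//.
by rewrite eseries0.
Qed.

Lemma null_bigcup_countable (I : countType) (F : I -> set V) :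
  (forall i, mu (F i) = 0) -> mu (\bigcup_i F i) = 0.
Proof.
move=> F0; pose G n := if unpickle n is Some i then F i else set0.
have <- : \bigcup_n G n = \bigcup_i F i.
  apply/seteqP; split => x.
    by move=> [n _]; rewrite /G; case: unpickle => // i Fx; exists i.
  by move=> [i _ Fx]; exists (pickle i) => //; rewrite /G pickleK.
by apply: null_bigcup => n; rewrite /G; case: unpickle => [i|]; rewrite ?lebesgue_outer0.
Qed.

Lemma measurable_approx (S : set T) : measurable S ->
  exists S' N, [/\ addition_measurable S', addition_measurable N, mu N = 0 &
    forall x, ~ N x -> S x <-> S' x].
Proof.
move=> mS; have mC n : measurable (cube n%:R : set T).
  have := measurable_affine_cube (1%:M : 'M[R]_d.+1) 0 n%:R; congr (measurable _).
  by apply/funext => x; rewrite /= /affine_map mulmx1 addr0.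
have /choice[F FP] : forall n : nat, exists SN : set V * set V,
    [/\ addition_measurable SN.1, addition_measurable SN.2, mu SN.2 = 0 &
    forall x, ~ SN.2 x -> (S `&` cube n%:R) x <-> SN.1 x].
  move=> n; have [||S' [N P]] := @measurable_approx_fin (S `&` cube n%:R).
  - exact: measurableI.
  - apply: le_lt_trans (@lebesgue_outer_cube_fin R d n%:R).
    by apply: le_lebesgue_outer => x [].
  - by exists (S', N).
exists (\bigcup_n (F n).1), (\bigcup_n (F n).2); split.
- by apply: addition_measurable_bigcup => n; case: (FP n).
- by apply: addition_measurable_bigcup => n; case: (FP n).
- by apply: null_bigcup => n; case: (FP n).
move=> x Nx; split => [Sx|[n _ Fx]].
  pose n := (Num.truncn `|x|).+1; exists n => //.
  have [_ _ _ FPn] := FP n; apply/FPn; first by move=> Nn; apply: Nx; exists n.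
  by split => //; rewrite /cube /= ltW// truncnS_gt.
have [_ _ _ FPn] := FP n.
by have [] : (S `&` cube n%:R) x by apply/FPn => // Nn; apply: Nx; exists n.
Qed.

Lemma measurable_fun_rat_rays d' (T' : measurableType d') (f : T' -> R) :
  (forall q : rat, measurable [set x | ratr q < f x]) -> measurable_fun setT f.
Proof.
move=> mf; apply: (measurability _ (RGenOInfty.measurableE R)) => _ [_ [t ->] <-].
rewrite setTI (_ : _ @^-1` _ = \bigcup_(q : rat)
    [set x | t <= ratr q /\ ratr q < f x]); last first.
  apply/seteqP; split => x /=.
    rewrite in_itv/= andbT => /rat_in_itvoo [q].
    by rewrite in_itv /= => /andP[tq qf]; exists q => //; split => //; exact: ltW.
  by move=> [q _ [tq qf]]; rewrite in_itv/= andbT (le_lt_trans tq).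
apply: countable_bigcupT_measurable => [|q]; first exact: countableP.
have [tq|qt] := leP t (ratr q).
  by rewrite (_ : [set x | _] = [set x | ratr q < f x])//; apply/seteqP; split => x //= -[].
by rewrite (_ : [set x | _] = set0)//; apply/seteqP; split => x //= -[].
Qed.

(** Rational rays suffice for measurability, so only countably many null sets are collected in N.
    Off N each ray of [g] agrees with an [addition_measurable] set; as g' is 0 on N, its rays
    contain or miss N according to the sign of q. *)
Lemma borel_version (g : T -> R) : measurable_fun setT g ->
  exists g' N, [/\ measurable_fun setT (g' : T -> R),
    measurable_fun setT (fun z : T * T => g' (z.1 + z.2 : V)),
    measurable (N : set T), mu N = 0 & forall x, ~ N x -> g x = g' x].
Proof.
move=> mg; have /choice[F FP] : forall q : rat, exists SN : set V * set V,
    [/\ addition_measurable SN.1, addition_measurable SN.2, mu SN.2 = 0 &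
    forall x, ~ SN.2 x -> ratr q < g x <-> SN.1 x].
  move=> q; have [|S' [N P]] := @measurable_approx [set x | ratr q < g x].
    rewrite (_ : [set x | _] = setT `&` g @^-1` `](ratr q), +oo[).
      exact: mg.
    by rewrite setTI; apply/seteqP; split => x /=; rewrite in_itv/= andbT.
  by exists (S', N).
pose N := \bigcup_q (F q).2.
pose g' x := if x \in N then 0 else g x.
have mN : addition_measurable N.
  by apply: addition_measurable_bigcup => q; case: (FP q).
have ray q : [set x | ratr q < g' x] =
    ((F q).1 `&` ~` N) `|` (if ratr q < 0 :> R then N else set0).
  apply/seteqP; split => x /=; rewrite /g'; case: (boolP (x \in N)).
  - by move=> /set_mem Nx q0; right; rewrite q0.
  - move=> /negP Nx qx; left; have nN : ~ N x by move=> /mem_set.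
    split => //; have [_ _ _ FPq] := FP q; apply/FPq => // Nq.
    by apply: nN; exists q.
  - by move=> /set_mem Nx [[]//|]; case: ifP.
  - move=> /negP Nx; have nN : ~ N x by move=> /mem_set.
    move=> [[Fx _]|]; last by case: ifP.
    by have [_ _ _ FPq] := FP q; apply/FPq => // Nq; apply: nN; exists q.
have mray q : addition_measurable [set x | ratr q < g' x].
  rewrite ray; apply: addition_measurableU.
    by apply: addition_measurableI; [case: (FP q)|exact: addition_measurableC].
  case: ifP => // _; rewrite -(setCK set0) setC0; split; first exact: measurableC.
  rewrite (_ : [set z | _] = set0)//.
  by apply/seteqP; split => x //=; exact.
exists g', N; split.
- by apply: measurable_fun_rat_rays => q; exact: (mray q).1.
- by apply: measurable_fun_rat_rays => q; exact: (mray q).2.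
- exact: mN.1.
- by apply: null_bigcup_countable => q; case: (FP q).
- by move=> x Nx; rewrite /g' memNset.
Qed.

End BorelVersion.

(** * Measurability of star-shaped sets *)

Section StarMeasurable.
Context {R : realType} {d : nat}.
Local Notation V := 'rV[R]_d.+1.
Local Notation T := (@lebesgue_type R d).
Local Notation mu := (@lebesgue_outer R d).

Lemma null_measurable (N : set T) : mu N = 0 -> measurable N.
Proof.
move=> N0; suff : caratheodory_measurable mu N by [].
apply: le_caratheodory_measurable => X.
rewrite -[leRHS]add0e; apply: leeD; [rewrite -N0|];
  by apply: le_lebesgue_outer => x [].
Qed.

Lemma mulmx_bounded (A : 'M[R]_d.+1) :
  exists2 C : R, 0 < C & forall v : V, `|v *m A| <= C * `|v|.
Proof.
pose S : R := \sum_j \sum_i `|A i j|.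
have S0 : 0 <= S by apply: sumr_ge0 => j _; apply: sumr_ge0.
exists (S + 1) => [|v]; first by rewrite ltr_wpDl.
apply: norm_le_coord => [|j]; first by rewrite mulr_ge0// addr_ge0.
rewrite mxE (le_trans (ler_norm_sum _ _ _))//.
apply: (@le_trans _ _ (\sum_i `|A i j| * `|v|)).
  apply: ler_sum => i _; rewrite normrM mulrC ler_wpM2l//; exact: coord_le_norm.
rewrite -mulr_suml ler_wpM2r// ler_wpDr// /S [leRHS](bigD1 j)//= lerDl.
by apply: sumr_ge0 => k _; apply: sumr_ge0.
Qed.

Lemma affine_map_inj (A : 'M[R]_d.+1) (b : V) : A \in unitmx ->
  injective (affine_map A b).
Proof.
move=> uA x y /addIr /(congr1 (fun v => v *m invmx A)).
by rewrite !mulmxK.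
Qed.

Definition rational_box (p : 'rV[rat]_d.+1 * nat) : set V :=
  box (\row_i (ratr (p.1 ord0 i) - p.2.+1%:R^-1), \row_i (ratr (p.1 ord0 i) + p.2.+1%:R^-1)).

Lemma rational_box_nbhs (y : V) (e : R) : 0 < e -> exists p, rational_box p y /\
  forall z, rational_box p z -> `|z - y| <= e.
Proof.
move=> e0; pose n := Num.truncn (2 / e); pose w : R := n.+1%:R^-1.
have w0 : 0 < w by rewrite invr_gt0.
have we : 2 * w <= e.
  by rewrite /w ler_pdivrMr// mulrC -ler_pdivrMr// ltW// truncnS_gt.
have /choice[q qP] : forall i, exists q : rat, y ord0 i - w < ratr q < y ord0 i + w.
  move=> i; have /rat_in_itvoo[q] : y ord0 i - w < y ord0 i + w by lra.
  by rewrite in_itv; exists q.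
exists (\row_i q i, n); split => [i|z zq].
  by rewrite !mxE in_itv/= -/w; have /andP[? ?] := qP i; apply/andP; split; lra.
apply: norm_le_coord => [|i]; first exact: ltW.
have := zq i; rewrite !mxE in_itv/= -/w; have /andP[? ?] := qP i => /andP[? ?].
by rewrite ler_norml; apply/andP; split; lra.
Qed.

Lemma bernoulli_le (e : R) n : 0 <= e <= 1 -> 1 - n%:R * e <= (1 - e) ^+ n.
Proof.
move=> /andP[e0 e1]; elim: n => [|n IH]; first by rewrite mul0r subr0.
rewrite exprS; have : (1 - e) * (1 - n%:R * e) <= (1 - e) * (1 - e) ^+ n.
  by rewrite ler_wpM2l// subr_ge0.
apply: le_trans; rewrite -natr1.
have : 0 <= n%:R * e * e by rewrite !mulr_ge0.
lra.
Qed.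

Lemma affine_cube_fin (A : 'M[R]_d.+1) (b : V) (t : R) : A \in unitmx ->
  (mu (affine_map A b @^-1` cube t) < +oo)%E.
Proof.
move=> uA; have [C C0 CA] := mulmx_bounded (invmx A).
apply: le_lt_trans (@lebesgue_outer_cube_fin R d (C * (t + `|b|))).
apply: le_lebesgue_outer => x xt.
have -> : x = (affine_map A b x - b) *m invmx A by rewrite addrK mulmxK.
rewrite /cube /= (le_trans (CA _))// ler_pM2l//.
by rewrite (le_trans (ler_normB _ _))// lerD2r.
Qed.

(* [Omega] lies between the open set of its interior points and dilations of
   that set with factors arbitrarily close to 1. *)
Lemma star_measurable (A : 'M[R]_d.+1) (b : V) (Omega : set V) (eta rho : R) :
  A \in unitmx -> 0 < eta -> star_at (affine_map A b @` Omega) (cube eta) ->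
  affine_map A b @` Omega `<=` cube rho -> measurable (Omega : set T).
Proof.
move=> uA eta0 star Orho.
pose U := \bigcup_p (if `[< rational_box p `<=` Omega >] then rational_box p else set0).
have mU : measurable (U : set T).
  apply: countable_bigcupT_measurable => [|p]; first exact: countableP.
  by case: ifP => _; [exact: measurable_box|exact: measurable0].
have UO : U `<=` Omega by move=> x [p _]; case: asboolP => // pO; exact: pO.
have [C C0 CA] := mulmx_bounded A.
pose a : V := - (b *m invmx A).
have Ta : affine_map A b a = 0 by rewrite /affine_map mulNmx mulmxKV// addNr.
have Tcomb (s : R) x : affine_map A b (s *: x + (1 - s) *: a) = s *: affine_map A b x.
  rewrite -[RHS]addr0 -(scaler0 _ (1 - s)) -Ta /affine_map mulmxDl -!scalemxAl.
  by rewrite !scalerDr addrACA -scalerDl addrCA subrr addr0 scale1r.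
(* [a] is the preimage of the centre. If |z - y| <= (1 - s) eta / C, then the image of z - y is 1 -
   s times a vector of [cube eta], so a whole rational box around y lies in Omega. *)
have dilate (s : R) x : 0 < s < 1 -> Omega x -> U (s *: x + (1 - s) *: a).
  move=> /andP[s0 s1] Ox; set y := _ + _.
  have s1' : 0 < 1 - s by rewrite subr_gt0.
  have [p [py pz]] := @rational_box_nbhs y ((1 - s) * eta / C) (divr_gt0 (mulr_gt0 s1' eta0) C0).
  exists p => //; case: asboolP => // -[] z zp.
  have [x' Ox' /(affine_map_inj uA) <- //] : (affine_map A b @` Omega) (affine_map A b z).
  have -> : affine_map A b z = (1 - (1 - s)) *: affine_map A b x +
      (1 - s) *: ((1 - s)^-1 *: ((z - y) *m A)).
    rewrite scalerA divff ?gt_eqF// scale1r subKr -Tcomb -/y /affine_map.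
    by rewrite mulmxBl [RHS]addrC addrA subrK.
  apply: star; [by exists x| |by rewrite (ltW s1') lerBlDr lerDl ltW].
  rewrite /cube /= normrZ normfV (gtr0_norm s1') ler_pdivrMl//.
  by rewrite (le_trans (CA _))// mulrC -ler_pdivlMr// pz.
have Ofin : (mu Omega < +oo)%E.
  apply: le_lt_trans (affine_cube_fin b rho uA).
  by apply: le_lebesgue_outer => x Ox; apply: Orho; exists x.
have le_dilate (s : R) : 0 < s < 1 -> ((s ^+ d.+1)%:E * mu Omega <= mu U)%E.
  move=> s01; have /andP[s0 s1] := s01.
  rewrite -(lebesgue_outer_affine ((1 - s) *: a) Omega s0).
  by apply: le_lebesgue_outer => _ [x Ox <-]; exact: dilate.
have D0 : mu (Omega `\` U) = 0.
  have cU : caratheodory_measurable mu U by [].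
  have := cU Omega; rewrite (setIidr UO) -setDE => muO.
  have v0 := lebesgue_outer_ge0 (Omega `\` U).
  have u0 := lebesgue_outer_ge0 U.
  move: muO Ofin le_dilate v0 u0.
  case: (mu U) => [u| |]; case: (mu (Omega `\` U)) => [v| |] -> //= _ dil.
  rewrite !lee_fin => v0 u0; congr (_%:E); apply/eqP; rewrite eq_le v0 andbT leNgt.
  apply/negP => vp.
  have uv : 0 < u + v by rewrite ltr_wpDl.
  pose n : R := d.+1%:R; have n0 : 1 <= n by rewrite ler1n.
  have den : 0 < 2 * (n * (u + v)) by rewrite !mulr_gt0// (lt_le_trans ltr01).
  (* Here u and v measure U and its complement in Omega. Dilation by 1 - e and Bernoulli give (1 - n
     e) (u + v) <= u, that is v <= n e (u + v) = v / 2, a contradiction. *)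
  pose e := v / (2 * (n * (u + v))).
  have e0 : 0 < e by rewrite divr_gt0.
  have e1 : e < 1.
    rewrite ltr_pdivrMr// mul1r.
    have : u + v <= n * (u + v) by rewrite ler_peMl// ltW.
    lra.
  have e01 : 0 < 1 - e < 1 by apply/andP; split; lra.
  have := dil _ e01; rewrite -EFinD -EFinM lee_fin.
  have e01' : 0 <= e <= 1 by rewrite !ltW.
  have h1 : (1 - n * e) * (u + v) <= (1 - e) ^+ d.+1 * (u + v).
    by rewrite ler_wpM2r ?bernoulli_le// ltW.
  have h2 : n * e * (u + v) = v / 2.
    rewrite /e; field.
    by rewrite !gt_eqF// (lt_le_trans ltr01).
  lra.
have -> : Omega = U `|` (Omega `\` U) by rewrite setDUK.
by apply: measurableU => //; exact: null_measurable.
Qed.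

End StarMeasurable.

(** * Selection of a good slice by Tonelli *)

Section TonelliAverage.
Local Open Scope ereal_scope.

Lemma le_integral_indic d (T : measurableType d) (R : realType)
    (m : {measure set T -> \bar R}) (F : T -> \bar R) (K : set T) (c : R) :
  measurable K -> measurable_fun setT F -> (forall x, 0 <= F x) -> (0 <= c)%R ->
  (forall x, F x <= c%:E * (\1_K x)%:E) -> \int[m]_x F x <= c%:E * m K.
Proof.
move=> mK mF F0 c0 Fc.
have mI : measurable_fun setT (fun x => (\1_K x)%:E : \bar R).
  by apply/measurable_EFinP; exact: measurable_indic.
rewrite -[X in m X]setIT -(integral_indic m measurableT mK).
rewrite -(ge0_integralZl_EFin m measurableT _ mI c0); last first.
  by move=> x _; rewrite lee_fin.
apply: (ge0_le_integral m measurableT) => //.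
by apply: measurable_funeM.
Qed.

Lemma ge_integral_indic d (T : measurableType d) (R : realType)
    (m : {measure set T -> \bar R}) (F : T -> \bar R) (K : set T) (c : R) :
  measurable K -> measurable_fun setT F -> (forall x, 0 <= F x) -> (0 <= c)%R ->
  (forall x, K x -> c%:E <= F x) -> c%:E * m K <= \int[m]_x F x.
Proof.
move=> mK mF F0 c0 Fc.
have mI : measurable_fun setT (fun x => (\1_K x)%:E : \bar R).
  by apply/measurable_EFinP; exact: measurable_indic.
rewrite -[X in m X]setIT -(integral_indic m measurableT mK).
rewrite -(ge0_integralZl_EFin m measurableT _ mI c0); last first.
  by move=> x _; rewrite lee_fin.
apply: (ge0_le_integral m measurableT) => //.
- by move=> x _; rewrite mule_ge0// lee_fin.
- by apply: measurable_funeM.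
move=> x _; rewrite indicE; case: (boolP (x \in K)) => [/set_mem Kx|_].
  by rewrite mule1 Fc.
by rewrite mule0.
Qed.

(** If every slice over [K] exceeded [D], the double integral would be at least D m1(K); in the
    other order it is at most c m2(L). *)
Lemma tonelli_average d1 d2 (T1 : measurableType d1) (T2 : measurableType d2)
    (R : realType) (m1 : {sigma_finite_measure set T1 -> \bar R})
    (m2 : {sigma_finite_measure set T2 -> \bar R}) (H : T1 * T2 -> \bar R)
    (K : set T1) (L : set T2) (c D : R) :
  measurable K -> measurable L -> measurable_fun setT H -> (forall z, 0 <= H z) ->
  (0 <= c)%R -> (0 <= D)%R ->
  (forall h, \int[m1]_x H (x, h) <= c%:E * (\1_L h)%:E) ->
  c%:E * m2 L < D%:E * m1 K ->
  exists2 x, K x & \int[m2]_h H (x, h) <= D%:E.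
Proof.
move=> mK mL mH H0 c0 D0 Hc cD; apply: contrapT => noK.
have KD x : K x -> D%:E <= \int[m2]_h H (x, h).
  by move=> Kx; rewrite leNgt; apply/negP => /ltW xD; apply: noK; exists x.
move: cD; rewrite ltNge => /negP; apply.
apply: (@le_trans _ _ (\int[m1]_x \int[m2]_h H (x, h))).
  apply: ge_integral_indic => //.
    exact: measurable_fun_fubini_tonelli_F.
  by move=> x; apply: integral_ge0.
rewrite fubini_tonelli//; apply: le_integral_indic => //.
  exact: measurable_fun_fubini_tonelli_G.
by move=> h; apply: integral_ge0.
Qed.

End TonelliAverage.

(** * A Poincare inequality valid for every p > 0 *)

Section PoincareAverage.
Context {R : realType} {d : nat}.
Local Notation V := 'rV[R]_d.+1.
Local Notation T := (@lebesgue_type R d).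
Local Notation mu := (@lebesgue_outer R d).
Local Notation lam := (@lebesgue_rV R d).

Lemma affine_cube_scale (A : 'M[R]_d.+1) (b b' : V) (t s : R) : A \in unitmx ->
  0 < t -> mu (affine_map A b' @^-1` cube (t * s)) =
  ((t ^+ d.+1)%:E * mu (affine_map A b @^-1` cube s))%E.
Proof.
move=> uA t0.
rewrite -(lebesgue_outer_affine ((t *: b - b') *m invmx A) _ t0); congr mu.
have image x : affine_map A b' (t *: x + (t *: b - b') *m invmx A) =
    t *: affine_map A b x.
  by rewrite /affine_map mulmxDl mulmxKV// -scalemxAl -addrA subrK scalerDr.
apply/seteqP; split => [h hs|_ [x xs <-]]; last first.
  by rewrite /cube /= image normrZ (gtr0_norm t0) ler_pM2l.
exists (t^-1 *: (h - (t *: b - b') *m invmx A)).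
  rewrite /cube /= -(ler_pM2l t0) -{1}(gtr0_norm t0) -normrZ -image.
  by rewrite scalerA divff ?gt_eqF// scale1r subrK.
by rewrite scalerA divff ?gt_eqF// scale1r subrK.
Qed.

(* Averaging over the steps [h] (Tonelli) yields a point [x] such that the
   constant [g x] is good. *)
Lemma poincare_average (A : 'M[R]_d.+1) (b : V) (s : R) (Phi : R -> R)
    (g : V -> R) (c : R) : A \in unitmx ->
  measurable_fun setT Phi -> (forall t, 0 <= Phi t) ->
  measurable_fun setT (g : T -> R) ->
  (0 < mu (affine_map A b @^-1` cube s) < +oo)%E ->
  (forall h, `|h *m A| <= 2 * s -> exists G : T -> \bar R,
    [/\ measurable_fun setT G, (forall x, 0 <= G x)%E,
      (forall x, (affine_map A b @^-1` cube s) x ->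
         ((Phi (g (x + h)%R - g x))%:E <= G x)%E) &
      (\int[lam]_x G x <= c%:E)%E]) ->
  exists a, (\int[lam]_(x in affine_map A b @^-1` cube s)
    (Phi (g x - a))%:E <= (2 ^+ d.+1 * (c + 1))%:E)%E.
Proof.
move=> uA mPhi Phi0 mg; set K := _ @^-1` _ => /andP[K0 Koo] HG.
(* These steps include all differences of two points of [K]. *)
pose K2 := [set h : V | `|h *m A| <= 2 * s].
have mK : measurable (K : set T) by exact: measurable_affine_cube.
have mK2 : measurable (K2 : set T).
  have := measurable_affine_cube A 0 (2 * s); congr (measurable _).
  by apply/funext => x; rewrite /affine_map /= addr0.
have c0 : 0 <= c.
  have [|G [_ G0 _ Gc]] := HG 0.
    rewrite mul0mx normr0.
    have [s0|s0] := leP 0 s; first by rewrite mulr_ge0.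
    move: K0; rewrite (_ : K = set0) ?outer_measure0 ?ltxx//.
    apply/seteqP; split => x //; rewrite /K /cube /=.
    by move=> /le_lt_trans /(_ s0); rewrite ltNge normr_ge0.
  by rewrite -lee_fin (le_trans _ Gc)// integral_ge0.
have mKadd : measurable ([set z | K (z.1 + z.2)] : set (T * T)).
  apply: (@measurable_preimage_cube _ _ _ _ (fun z : T * T => affine_map A b (z.1 + z.2 : V))) => i.
  rewrite (_ : (fun _ => _) = (fun z : T * T =>
    affine_map A b z.1 ord0 i + affine_map A 0 z.2 ord0 i)); last first.
    by apply/funext => z; rewrite /affine_map mulmxDl !mxE addr0 addrAC.
  apply: measurable_funD.
  - exact: (measurableT_comp (measurable_affine_coord A b i) measurable_fst).
  - exact: (measurableT_comp (measurable_affine_coord A 0 i) measurable_snd).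
have [g' [N [mg' mg'add mN N0 gg']]] := borel_version mg.
(* Both x and x + h are kept in [K], so the integrand vanishes for steps outside [K2]; [g'] replaces
   [g] to make it jointly measurable. *)
pose H (z : T * T) : \bar R := (Phi (g' (z.1 + z.2 : V) - g' z.1) *
  (\1_K z.1 * \1_[set z | K (z.1 + z.2)] z))%:E.
have H0 z : (0 <= H z)%E by rewrite lee_fin !mulr_ge0.
have mH : measurable_fun setT H.
  apply/measurable_EFinP; apply: measurable_funM.
    apply: (measurableT_comp mPhi); apply: measurable_funB => //.
    exact: (measurableT_comp mg' measurable_fst).
  apply: measurable_funM; last exact: measurable_indic.
  by apply: (measurableT_comp _ measurable_fst); exact: measurable_indic.
have inner h : (\int[lam]_x H (x, h) <= c%:E * (\1_K2 h)%:E)%E.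
  rewrite indicE; case: (boolP (h \in K2)) => [/set_mem hK2|/negP hK2].
    have [G [mG G0 GK Gc]] := HG h hK2; rewrite mule1; apply: le_trans Gc.
    apply: ae_ge0_le_integral.
    - exact: measurableT.
    - by move=> x _; exact: H0.
    - exact: (measurableT_comp mH (pair2_measurable h)).
    - by move=> x _; exact: G0.
    - exact: mG.
    pose Nh := [set x : V | N (x + h)].
    exists (N `|` Nh); split.
    - by apply: measurableU; [exact: mN|exact: measurable_shift].
    - apply/eqP; rewrite eq_le [X in _ && X]lebesgue_outer_ge0 andbT.
      apply: (@le_trans _ _ (mu N + mu Nh)%E); first exact: outer_measureU2.
      by rewrite lebesgue_outer_shift N0 add0e.
    move=> x /= nP; apply: contrapT => nN; apply: nP => _.
    have Nx : ~ N x by move=> ?; apply: nN; left.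
    have Nxh : ~ N (x + h : V) by move=> ?; apply: nN; right.
    rewrite /H /=.
    rewrite -(gg' _ Nx) -(gg' _ Nxh) !indicE.
    case: (boolP (x \in K)) => [/set_mem Kx|_]; last by rewrite mul0r mulr0; exact: G0.
    apply: le_trans (GK x Kx); rewrite lee_fin mul1r ler_piMr//.
    by case: (_ \in _).
  rewrite mule0 integral0_eq// => x _; rewrite /H /= !indicE.
  case: (boolP (x \in K)) => [/set_mem Kx|_]; last by rewrite mul0r mulr0.
  case: (boolP (_ \in _)) => [/set_mem /= Kxh|_]; last by rewrite !mulr0.
  exfalso; apply: hK2; apply/mem_set; rewrite /K2 /=.
  have -> : (h : V) *m A = affine_map A b (x + h : V) - affine_map A b (x : V).
    by rewrite /affine_map mulmxDl (addrC (_ *m _)) -(addrA _ _ b) addrK.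
  rewrite (le_trans (ler_normB _ _))//.
  by have := lerD Kxh Kx; rewrite -mulr2n mulr_natl.
(* [K2] has 2^(d+1) times the measure of [K]; the summand 1 makes the comparison strict even when c
   = 0. *)
pose D := 2 ^+ d.+1 * (c + 1).
have D0 : 0 <= D by rewrite mulr_ge0 ?exprn_ge0// addr_ge0.
have cD : (c%:E * mu K2 < D%:E * mu K)%E.
  have -> : mu K2 = ((2 ^+ d.+1)%:E * mu K)%E.
    rewrite -(affine_cube_scale b 0 s uA (ltr0Sn R 1)); congr mu.
    by apply/funext => h; rewrite /K2 /affine_map /= addr0.
  move: K0 Koo; case: (mu K) => [k| |]// k0 _.
  rewrite -!EFinM lte_fin /D mulrA [c * _]mulrC ltr_pM2r//.
  by rewrite ltr_pM2l ?exprn_gt0// ltrDl.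
have [x Kx xD] := tonelli_average (m1 := lam) (m2 := lam) mK mK2 mH H0 c0 D0 inner cD.
exists (g' x); apply: le_trans xD.
(* For the selected x the substitution y = x + h turns the integral over steps into one over [K]. *)
pose Psi (y : T) : \bar R := (Phi (g' y - g' x) * \1_K y)%:E.
have Psi0 y : (0 <= Psi y)%E by rewrite lee_fin mulr_ge0.
have mPsi : measurable_fun setT Psi.
  apply/measurable_EFinP; apply: measurable_funM; last exact: measurable_indic.
  by apply: (measurableT_comp mPhi); exact: measurable_funB.
have -> : (\int[lam]_h H (x, h) = \int[lam]_h Psi (h + x : V)%R)%E.
  apply: eq_integral => h _; rewrite /H /Psi /= [h + x]addrC; congr (_%:E).
  by rewrite !indicE mem_set// mul1r; congr (_ * _).
rewrite (ge0_integral_shift _ mPsi Psi0).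
rewrite integral_mkcond.
apply: ae_ge0_le_integral.
- exact: measurableT.
- by move=> y _; rewrite patchE; case: ifP => // _; rewrite lee_fin.
- apply/(measurable_restrictT _ mK); apply/measurable_EFinP.
  apply: measurable_funTS; apply: (measurableT_comp mPhi).
  by apply: measurable_funB => //; exact: measurable_cst.
- by move=> y _; exact: Psi0.
- exact: mPsi.
exists N; split => // y /= nP; apply: contrapT => Ny; apply: nP => _.
rewrite /Psi -(gg' _ Ny) indicE patchE.
by case: ifP => _; rewrite ?mulr1 ?mulr0.
Qed.

End PoincareAverage.

(** * The size for finite p *)

Section LpGauge.
Context {R : realType} {d : nat}.
Local Notation V := 'rV[R]_d.+1.
Local Notation T := (@lebesgue_type R d).
Local Notation mu := (@lebesgue_outer R d).
Local Notation lam := (@lebesgue_rV R d).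
Variables (p : R) (A : 'M[R]_d.+1) (b : V) (s tau : R).
Hypotheses (p_gt0 : 0 < p) (uA : A \in unitmx) (tau_gt0 : 0 < tau).
Local Notation aff := (affine_map A b).

(* The p-th power of the L^p norm, as an upper integral, of a function given in
   the coordinates [aff x]; [tau] normalizes the measure. *)
Definition Lp_bound (K : set V) (g : V -> R) (c : R) :=
  exists G : T -> \bar R, [/\ measurable_fun setT G, (forall x, 0 <= G x)%E,
    (forall x : V, K (aff x) -> (((tau * `|g (aff x)|) `^ p)%:E <= G x)%E) &
    (\int[lam]_x G x <= c%:E)%E].

Definition affine_mfun : set (V -> R) :=
  [set g | measurable_fun setT ((fun x => g (aff x)) : T -> R)].

Lemma affine_mapD_invmx x h : aff (x + h *m invmx A) = aff x + h.
Proof. by rewrite /affine_map mulmxDl mulmxKV// addrAC. Qed.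

Lemma affine_mapD x h : aff (x + h) = aff x + h *m A.
Proof. by rewrite /affine_map mulmxDl addrAC. Qed.

(** From x + y <= 2 max(x, y); the constant 2^p serves p < 1 and p >= 1 alike. *)
Lemma powR_addr_le (x y : R) : 0 <= x -> 0 <= y ->
  (x + y) `^ p <= 2 `^ p * (x `^ p + y `^ p).
Proof.
move=> x0 y0.
have M0 : 0 <= Num.max x y by rewrite le_max x0.
apply: (@le_trans _ _ ((2 * Num.max x y) `^ p)).
  apply: (ge0_ler_powR (ltW p_gt0)); rewrite ?nnegrE ?addr_ge0 ?mulr_ge0//.
  have : x <= Num.max x y by rewrite le_max lexx.
  have : y <= Num.max x y by rewrite le_max lexx orbT.
  lra.
rewrite powRM// ler_wpM2l ?powR_ge0// maxEle.
by case: ifP => _; rewrite ?lerDl ?lerDr powR_ge0.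
Qed.

Lemma powR_norm_mono (x y : R) : `|x| <= `|y| ->
  (tau * `|x|) `^ p <= (tau * `|y|) `^ p.
Proof.
have t0 := ltW tau_gt0.
by move=> xy; apply: (ge0_ler_powR (ltW p_gt0)); rewrite ?nnegrE ?mulr_ge0 ?ler_wpM2l.
Qed.

Lemma measurable_powR_scale : measurable_fun setT (fun t : R => (tau * `|t|) `^ p).
Proof.
apply: (measurableT_comp (measurable_powR p)).
by apply: measurable_funM => //; exact: measurable_normr.
Qed.

Lemma measurable_poly_aff n P : poly_of_degree_lt n P -> affine_mfun P.
Proof.
move=> [q nq ->]; move: nq.
apply: (poly_fun_ind (P := fun _ f => affine_mfun f)).
- by move=> _; exact: measurable_cst.
- by move=> _ c; exact: measurable_cst.
- by move=> _ f g mf mg; exact: measurable_funD mf mg.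
- by move=> _ i f mf; exact: measurable_funM (measurable_affine_coord A b i) mf.
- by move=> _ f c mf; exact: measurable_funM (measurable_cst c) mf.
Qed.

Lemma integral_cst_cube (a t : R) : 0 <= a ->
  (\int[lam]_x (a * \1_(aff @^-1` cube t) x)%:E = a%:E * mu (aff @^-1` cube t))%E.
Proof.
move=> a0; have mK : measurable (aff @^-1` cube t : set T) := measurable_affine_cube A b t.
have mI : measurable_fun setT (fun x : T => (\1_(aff @^-1` cube t) x)%:E : \bar R).
  by apply/measurable_EFinP; exact: measurable_indic.
under eq_integral do rewrite EFinM.
rewrite (ge0_integralZl_EFin lam measurableT _ mI a0); last first.
  by move=> x _; rewrite lee_fin.
by rewrite (integral_indic lam measurableT mK) setIT.
Qed.

(** The normalization keeps the determinant of [A] out of all parameters. 2^p is the quasi-triangle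
    constant for p-th powers, 2^(d+1) comes from the Poincare inequality, and the two functions undo
    a p-th power and scale by one. *)
Lemma Lp_gauge (v : R) : 0 <= s -> 0 < v -> mu (aff @^-1` cube s) = v%:E ->
  tau `^ p * v = 1 ->
  gauge (2 `^ p) (2 ^+ d.+1) s (fun c => c `^ p^-1) (fun a => `|a| `^ p)
    affine_mfun Lp_bound.
Proof.
move=> s0 v0 muK tauv; have t0 := ltW tau_gt0; have p0 := ltW p_gt0.
have mK t : measurable (aff @^-1` cube t : set T) := measurable_affine_cube A b t.
have taup0 : 0 < tau `^ p by rewrite powR_gt0.
have one_bound t w : mu (aff @^-1` cube t) = w%:E ->
    Lp_bound (cube t) (cst 1) (tau `^ p * w).
  move=> muw; exists (fun x => (tau `^ p * \1_(aff @^-1` cube t) x)%:E); split.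
  - apply/measurable_EFinP; apply: measurable_funM => //; exact: measurable_indic.
  - by move=> x; rewrite lee_fin mulr_ge0// powR_ge0.
  - by move=> x xt; rewrite normr1 mulr1 indicE mem_set// mulr1.
  - by rewrite integral_cst_cube ?powR_ge0// muw -EFinM.
split.
- move=> K K' g g' c KK' gg' [G [mG G0 GK Gc]]; exists G; split => // x Kx.
  by apply: le_trans (GK x (KK' _ Kx)); rewrite lee_fin; exact/powR_norm_mono/gg'.
- move=> K; exists (cst 0%E); split => //; last by rewrite integral0.
  by move=> x _; rewrite normr0 mulr0 powR0 ?gt_eqF.
- move=> K g g' c c' [G [mG G0 GK Gc]] [G' [mG' G'0 GK' Gc']].
  exists (fun x => ((2 `^ p)%:E * (G x + G' x))%E); split.
  + by apply: measurable_funeM; exact: emeasurable_funD.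
  + by move=> x; rewrite mule_ge0 ?adde_ge0// lee_fin powR_ge0.
  + move=> x Kx; apply: (@le_trans _ _ ((2 `^ p)%:E *
      (((tau * `|g (aff x)|) `^ p)%:E + ((tau * `|g' (aff x)|) `^ p)%:E))%E).
      rewrite -EFinD -EFinM lee_fin.
      apply: le_trans (powR_addr_le _ _); rewrite ?mulr_ge0// -mulrDr.
      apply: (ge0_ler_powR p0); rewrite ?nnegrE ?mulr_ge0 ?addr_ge0//.
      by rewrite ler_wpM2l// ler_normD.
    by rewrite lee_pmul2l ?lte_fin ?powR_gt0// leeD ?GK ?GK'.
  + have mGG : measurable_fun setT (fun x => G x + G' x)%E by exact: emeasurable_funD.
    rewrite (ge0_integralZl_EFin lam measurableT _ mGG (powR_ge0 _ _)); last first.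
      by move=> x _; rewrite adde_ge0.
    rewrite (ge0_integralD lam measurableT (fun x _ => G0 x) mG (fun x _ => G'0 x) mG').
    by rewrite EFinM lee_pmul2l ?lte_fin ?powR_gt0// EFinD leeD.
- move=> K K' g c c' [G [mG G0 GK Gc]] [G' [mG' G'0 GK' Gc']].
  exists (fun x => (G x + G' x)%E); split.
  + exact: emeasurable_funD.
  + by move=> x; rewrite adde_ge0.
  + move=> x [Kx|Kx]; first by rewrite -[leLHS]adde0 leeD ?GK.
    by rewrite -[leLHS]add0e leeD ?GK'.
  + rewrite (ge0_integralD lam measurableT (fun x _ => G0 x) mG (fun x _ => G'0 x) mG').
    by rewrite EFinD leeD.
- move=> K g c h [G [mG G0 GK Gc]].
  exists (fun x => G (x + h *m invmx A : V)); split.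
  + exact: (measurableT_comp mG (measurable_fun_shift _)).
  + by move=> x; exact: G0.
  + by move=> x Kx; rewrite -affine_mapD_invmx; apply: GK; rewrite affine_mapD_invmx.
  + by rewrite (ge0_integral_shift _ mG G0).
- move=> K g c a [G [mG G0 GK Gc]].
  exists (fun x => ((`|a| `^ p)%:E * G x)%E); split.
  + exact: measurable_funeM.
  + by move=> x; rewrite mule_ge0// lee_fin powR_ge0.
  + move=> x Kx; rewrite normrM mulrCA powRM ?mulr_ge0// EFinM.
    by rewrite lee_wpmul2l ?GK// lee_fin powR_ge0.
  + rewrite (ge0_integralZl_EFin lam measurableT (fun x _ => G0 x) mG (powR_ge0 _ _)).
    by rewrite EFinM lee_wpmul2l// lee_fin powR_ge0.
- by have := one_bound s v muK; rewrite tauv.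
- move=> a c [G [mG G0 GK Gc]].
  have le1 : (((tau * `|a|) `^ p)%:E * v%:E <= c%:E)%E.
    apply: le_trans Gc; rewrite -muK; apply: ge_integral_indic => //.
    by rewrite powR_ge0.
  rewrite -EFinM lee_fin powRM// mulrAC tauv mul1r in le1.
  have ap0 := powR_ge0 `|a| p.
  rewrite -[leLHS]powRr1// -(divff (lt0r_neq0 p_gt0)) powRrM.
  by apply: ge0_ler_powR; rewrite ?nnegrE ?invr_ge0// (le_trans ap0).
- move=> t; have : (mu (aff @^-1` cube t) < +oo)%E := affine_cube_fin b t uA.
  case E : (mu _) => [w| |] // _; first by exists (tau `^ p * w); exact: one_bound.
  by have := lebesgue_outer_ge0 (aff @^-1` cube t); rewrite E.
- move=> g c mg Hg.
  have [||h hs|a Ha] := @poincare_average R d A b s (fun t => (tau * `|t|) `^ p)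
    (fun x => g (aff x)) c uA measurable_powR_scale _ mg.
  + by move=> t; exact: powR_ge0.
  + by rewrite muK lte_fin v0 ltry.
  + have [G [mG G0 GK Gc]] := Hg (h *m A) hs; exists G; split => // x xs.
    by rewrite affine_mapD; exact: GK.
  exists a; exists ((fun x => ((tau * `|g (aff x) - a|) `^ p)%:E) \_ (aff @^-1` cube s)); split.
  + apply/(measurable_restrictT _ (mK s)); apply/measurable_EFinP.
    apply: measurable_funTS; apply: (measurableT_comp measurable_powR_scale).
    exact: measurable_funB mg (measurable_cst a).
  + by move=> x; rewrite patchE; case: ifP => // _; rewrite lee_fin powR_ge0.
  + by move=> x xs; rewrite patchE mem_set.
  + by rewrite -integral_mkcond.
- move=> g h mg.
  rewrite /affine_mfun /= (_ : (fun _ => _) =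
      (fun x : T => g (aff (x + h *m invmx A)) - g (aff x))); last first.
    by apply/funext => x; rewrite affine_mapD_invmx.
  exact: measurable_funB (measurableT_comp mg (measurable_fun_shift _)) mg.
- by move=> g n P mg /measurable_poly_aff mP; exact: measurable_funB mg mP.
Qed.

End LpGauge.

(** * Euclidean balls, cubes and the modulus of smoothness *)

Section EuclideanNorm.
Context {R : realType} {d : nat}.
Local Notation V := 'rV[R]_d.+1.
Implicit Types (x h : V) (Omega : set V).

Lemma enorm_ge0 x : 0 <= enorm x.
Proof. exact: sqrtr_ge0. Qed.

Lemma norm_le_enorm x : `|x| <= enorm x.
Proof.
apply: norm_le_coord => [|i]; first exact: enorm_ge0.
rewrite -sqrtr_sqr ler_wsqrtr// (bigD1 i)//= lerDl.
by apply: sumr_ge0 => j _; exact: sqr_ge0.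
Qed.

(** The square of each coordinate is at most its absolute value, hence at most 1/(d + 1). *)
Lemma enorm_le1 x : `|x| <= d.+1%:R^-1 -> enorm x <= 1.
Proof.
move=> xd; rewrite -sqrtr1 ler_wsqrtr//.
have w0 : 0 <= d.+1%:R^-1 :> R by rewrite invr_ge0.
apply: (@le_trans _ _ (\sum_(i < d.+1) d.+1%:R^-1)); last first.
  by rewrite sumr_const card_ord -[leLHS]mulr_natl divff ?pnatr_eq0.
apply: ler_sum => i _; have xi := le_trans (coord_le_norm x i) xd.
rewrite -real_normK ?num_real// expr2 -[leRHS]mulr1 ler_pM//.
by rewrite (le_trans xi)// invf_le1 ?ltr0n// ler1n.
Qed.

Lemma enormZ (a : R) x : enorm (a *: x) = `|a| * enorm x.
Proof.
rewrite /enorm -sqrtr_sqr -sqrtrM ?sqr_ge0// mulr_sumr; congr Num.sqrt.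
by apply: eq_bigr => i _; rewrite mxE exprMn.
Qed.

Lemma enorm_eq0 x : enorm x = 0 -> x = 0.
Proof.
by move=> x0; apply/eqP; rewrite -normr_le0 -x0 norm_le_enorm.
Qed.

Lemma star_shaped_star_at Omega : star_shaped Omega (eball 0 1) ->
  star_at Omega (cube d.+1%:R^-1).
Proof.
move=> star x y t Ox yd /andP[t0 t1]; apply: (star x Ox) => C [[cC _] sub].
have Cx : C x by apply: sub; left.
have Cy : C y by apply: sub; right; rewrite /eball /= subr0 enorm_le1.
have := cC y x (Itv01 t0 t1) (mem_set Cy) (mem_set Cx).
by rewrite addrC => /set_mem.
Qed.

(** A point x of the domain has x and x + h in Omega, as r > 0, so the length of h is at most the
    diameter. For h = 0 any unit vector serves as direction. *)
Lemma modulus_ge (p : \bar R) r f Omega h : (0 < r)%N ->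
  difference_domain Omega r h !=set0 ->
  (Lp_norm p (difference_domain Omega r h) (finite_difference r h f)
    <= modulus r f Omega p)%E.
Proof.
move=> r0 [x xh].
have [xi [xi1 hxi]] : exists xi : V, enorm xi = 1 /\ enorm h *: xi = h.
  have [h0|h0] := eqVneq (enorm h) 0.
    exists (delta_mx ord0 ord0); split; last by rewrite h0 scale0r (enorm_eq0 h0).
    rewrite /enorm (bigD1 ord0)//= big1; last first.
      by move=> i i0; rewrite mxE (negbTE i0) andbF expr0n.
    by rewrite mxE !eqxx expr1n addr0 sqrtr1.
  exists ((enorm h)^-1 *: h); split; last by rewrite scalerA divff// scale1r.
  by rewrite enormZ ger0_norm ?invr_ge0 ?enorm_ge0// mulVf.
have diam : ((enorm h)%:E <= ediam Omega)%E.
  apply: ereal_sup_ubound => /=; exists (x + h); first exact: (xh 1%N r0).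
  exists x; last by rewrite addrC addKr.
  by have := xh 0%N (leq0n r); rewrite addr0.
apply: (@le_trans _ _ (ereal_sup [set Lp_norm p (difference_domain Omega r (u *: xi))
   (finite_difference r (u *: xi) f) | u in [set u : R | (`|u|%:E <= ediam Omega)%E]])).
  apply: ereal_sup_ubound; exists (enorm h); last by rewrite hxi.
  by rewrite /= ger0_norm ?enorm_ge0.
by apply: ereal_sup_ubound; exists xi.
Qed.

End EuclideanNorm.

(** * Affine substitution in polynomials *)

Section AffinePolynomials.
Context {R : realType} {d : nat}.
Local Notation V := 'rV[R]_d.+1.

Lemma poly_of_degree_lt_affine (A : 'M[R]_d.+1) (b : V) n (Q : V -> R) :
  poly_of_degree_lt n Q -> poly_of_degree_lt n (fun x => Q (affine_map A b x)).
Proof.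
move=> [q nq ->]; move: n q nq.
apply: (poly_fun_ind (P := fun n f => poly_of_degree_lt n (fun x => f (affine_map A b x)))).
- by move=> n; exact: poly_of_degree_lt0.
- by move=> n c; exact: poly_of_degree_lt_cst.
- by move=> n f g; exact: poly_of_degree_ltD.
- move=> n i f nf; rewrite (_ : (fun _ => _) = (fun x =>
      (x *m A) ord0 i * f (affine_map A b x) + b ord0 i * f (affine_map A b x))).
    apply: poly_of_degree_ltD; first exact: poly_of_degree_lt_coord.
    by apply: poly_of_degree_ltZ; apply: poly_of_degree_ltW nf.
  by apply/funext => x; rewrite /affine_map mxE mulrDl.
- by move=> n f c; exact: poly_of_degree_ltZ.
Qed.

End AffinePolynomials.

(** * The size for p = +oo *)

Section SupGauge.
Context {R : realType} {d : nat}.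
Local Notation V := 'rV[R]_d.+1.

(** The condition on the sign makes c + c' a bound on a union, even when one of the sets is
    empty. *)
Definition sup_bound (K : set V) (g : V -> R) (c : R) :=
  0 <= c /\ forall x, K x -> `|g x| <= c.

Lemma sup_gauge (s : R) : 0 <= s -> gauge 1 1 s id Num.norm setT sup_bound.
Proof.
move=> s0; have cube0 t : 0 <= t -> cube t (0 : V) by rewrite /cube /= normr0.
split => //.
- move=> K K' g g' c KK' gg' [c0 Bg']; split => // x Kx.
  by rewrite (le_trans (gg' x Kx))// Bg'//; exact: KK'.
- by move=> K; split => // x _; rewrite normr0.
- move=> K g g' c c' [c0 Bg] [c'0 Bg']; rewrite mul1r.
  split => [|x Kx]; first exact: addr_ge0.
  by rewrite (le_trans (ler_normD _ _))// lerD ?Bg ?Bg'.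
- move=> K K' g c c' [c0 Bg] [c'0 Bg']; split => [|x [Kx|Kx]].
  + exact: addr_ge0.
  + by rewrite (le_trans (Bg x Kx))// lerDl.
  + by rewrite (le_trans (Bg' x Kx))// lerDr.
- by move=> K g c h [c0 Bg]; split => // x Kx; exact: Bg.
- move=> K g c a [c0 Bg]; split => [|x Kx]; first by rewrite mulr_ge0.
  by rewrite normrM ler_wpM2l// Bg.
- by split => // x _; rewrite normr1.
- by move=> a c [_ Ba]; apply: (Ba 0); exact: cube0.
- by move=> t; exists 1; split => // x _; rewrite normr1.
(* g(x) - g(0) is the difference of step x at the point 0. *)
- move=> g c _ Bg; exists (g 0); rewrite mul1r.
  have [c0 _] : sup_bound (cube s) (fdiff 0 g) c by apply: Bg; rewrite normr0 mulr_ge0.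
  split => [|x xs]; first exact: addr_ge0.
  have xs' : `|x| <= 2 * s by rewrite (le_trans xs)// ler_peMl// ler1n.
  have [_ /(_ 0 (cube0 _ s0))] := Bg x xs'.
  by rewrite /fdiff add0r => /le_trans; apply; rewrite lerDl.
Qed.

End SupGauge.

(** * Whitney's inequality on the class, for p = +oo and for finite p *)

Section WhitneyInequality.
Context {R : realType} {d : nat}.
Local Notation V := 'rV[R]_d.+1.
Local Notation T := (@lebesgue_type R d).
Local Notation mu := (@lebesgue_outer R d).
Local Notation lam := (@lebesgue_rV R d).

Lemma affine_map_step (A : 'M[R]_d.+1) (b x h : V) j : A \in unitmx ->
  affine_map A b (x + h *m invmx A *+ j) = affine_map A b x + h *+ j.
Proof. by move=> uA; rewrite -scaler_nat scalemxAl scaler_nat affine_mapD_invmx. Qed.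

Lemma finite_difference_affine (A : 'M[R]_d.+1) (b : V) r h (g : V -> R) x :
  A \in unitmx -> finite_difference r h g (affine_map A b x) =
  finite_difference r (h *m invmx A) (fun y => g (affine_map A b y)) x.
Proof. by move=> uA; apply: eq_bigr => j _; rewrite affine_map_step. Qed.

Lemma difference_domain_affine (A : 'M[R]_d.+1) (b : V) (Omega : set V) r h x :
  A \in unitmx -> difference_domain (affine_map A b @` Omega) r h (affine_map A b x) ->
  difference_domain Omega r (h *m invmx A) x.
Proof.
move=> uA dx j jr; have [y Oy] := dx j jr.
by rewrite -affine_map_step// => /(affine_map_inj uA) <-.
Qed.

Lemma star_class_cube (A : 'M[R]_d.+1) (b : V) (Omega : set V) (rho : R) :
  star_shaped (affine_map A b @` Omega) (eball 0 1) ->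
  affine_map A b @` Omega `<=` eball 0 rho -> Omega !=set0 ->
  [/\ star_at (affine_map A b @` Omega) (cube d.+1%:R^-1),
      cube d.+1%:R^-1 `<=` affine_map A b @` Omega &
      affine_map A b @` Omega `<=` cube rho].
Proof.
move=> /star_shaped_star_at star sub [x0 Ox0]; split => //.
- move=> y yd; have := star _ _ 1 (ex_intro2 _ _ x0 Ox0 erefl) yd.
  by rewrite subrr scale0r scale1r add0r; apply; rewrite ler01 lexx.
- move=> y /sub; rewrite /eball /= subr0; apply: le_trans; exact: norm_le_enorm.
Qed.

(** The norm is taken over the closure, while the extension argument bounds points of Omega only;
    continuity on the closure bridges the gap. *)
Lemma sup_norm_le (Omega : set V) (f : V -> R) (q : mpoly d.+1 R) (c : R) :
  Lp_space +oo%E Omega f -> 0 <= c ->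
  (forall x, Omega x -> `|f x - poly_fun q x| <= c) ->
  (Lp_norm +oo%E Omega (f \- poly_fun q)%R <= c%:E)%E.
Proof.
rewrite /Lp_norm eqxx => cf c0 Oc.
have {}cf : {within closure Omega, continuous f} by [].
apply: ge_ereal_sup => _ [->|[x Ox <-]]; first by rewrite lee_fin.
rewrite lee_fin.
have cq : continuous (poly_fun q).
  apply: (poly_fun_ind (P := fun _ f => continuous f)) (leqnn (mmeasure mdeg q)).
  - by move=> _; exact: cst_continuous.
  - by move=> _ a; exact: cst_continuous.
  - by move=> _ g h cg ch y; exact: (cvgD (cg y) (ch y)).
  - move=> _ i g cg y; exact: (cvgM (@coord_continuous R 1 d.+1 ord0 i y) (cg y)).
  - by move=> _ g a cg y; exact: (cvgM (cvg_cst a) (cg y)).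
rewrite leNgt; apply/negP => cx.
have cvgf : (fun y => `|f y - poly_fun q y|) @ within (closure Omega) (nbhs x) -->
    `|f x - poly_fun q x|.
  apply: cvg_norm; apply: cvgB; first by move/subspace_continuousP: cf; apply.
  by move=> S /cq; rewrite /= nbhs_simpl /=; apply: filterS => y Sy _.
have FF : Filter (within (closure Omega) (nbhs x)) by exact: within_filter.
have : \forall y \near within (closure Omega) (nbhs x), c < `|f y - poly_fun q y|.
  exact: (cvgr_gt _ cvgf c cx).
rewrite near_withinE => /Ox [y [Oy /(_ (subset_closure Oy))]].
by rewrite ltNge Oc.
Qed.

(** The closure is compact. The bound depends on [f] and feeds only the qualitative hypothesis of
    [gauge_whitney]. *)
Lemma continuous_closure_bounded (A : 'M[R]_d.+1) (b : V) (Omega : set V)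
    (f : V -> R) (rho : R) :
  A \in unitmx -> affine_map A b @` Omega `<=` cube rho ->
  {within closure Omega, continuous f} ->
  exists2 M, 0 <= M & forall x, Omega x -> `|f x| <= M.
Proof.
move=> uA Orho cf; have [C C0 CA] := mulmx_bounded (invmx A).
pose r := C * (rho + `|b|).
have Or x : Omega x -> `|x| <= r.
  move=> Ox; have -> : x = (affine_map A b x - b) *m invmx A by rewrite addrK mulmxK.
  rewrite (le_trans (CA _))// ler_pM2l// (le_trans (ler_normB _ _))// lerD2r.
  by apply: Orho; exists x.
have cO : compact (closure Omega).
  apply: bounded_closed_compact; last exact: closed_closure.
  exists r; split; first exact: num_real.
  move=> M rM x Ox.
  rewrite /= (le_trans _ (ltW rM))// leNgt; apply/negP => rx.
  have /Ox[y [Oy]] : \forall y \near x, r < `|y|.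
    exact: (cvgr_gt _ (@norm_continuous R V x) r rx).
  by rewrite /= ltNge Or.
have [N [_ fN]] := compact_bounded (continuous_compact cf cO).
exists (`|N| + 1) => [|x Ox]; first by rewrite addr_ge0.
apply: (fN _ _ (f x)); first by rewrite ltr_pwDr// ler_norm.
by exists x => //; exact: subset_closure.
Qed.

Theorem whitney_sup r rho : (0 < r)%N ->
  exists2 C : R, 0 <= C &
  forall (Omega : set V) f, star_class rho Omega -> Lp_space +oo%E Omega f ->
  (modulus r f Omega +oo%E <= 1)%E ->
  exists2 q, poly_space r q & (Lp_norm +oo%E Omega (f \- poly_fun q)%R <= C%:E)%E.
Proof.
move=> r0; pose eta : R := d.+1%:R^-1; pose s := eta / 2 / r.+1%:R ^+ 2.
have eta0 : 0 < eta by rewrite invr_gt0.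
have s0 : 0 < s by rewrite !divr_gt0// exprn_gt0.
have seta : 2 * s * r.+1%:R ^+ 2 <= eta.
  by rewrite /s mulrA divfK ?expf_neq0 ?pnatr_eq0// mulrC divfK.
have [C HC] := @gauge_whitney R d 1 1 s id Num.norm s0 r eta rho r0 seta.
exists `|C| => // Omega f [A [b [uA star Orho]]] cf fr.
have [empty|On0] := eqVneq Omega set0.
  exists (mpolyC d.+1 0); first by rewrite /poly_space /= mmeasureC eqxx.
  by apply: sup_norm_le => // x; rewrite empty.
have {On0}/set0P On0 := On0.
have [starO cubeO Ocube] := star_class_cube star Orho On0.
pose g y := f ((y - b) *m invmx A).
have gE x : g (affine_map A b x) = f x by rewrite /g addrK mulmxK.
have gE' : (fun x => g (affine_map A b x)) = f by apply/funext.
have [M M0 fM] := continuous_closure_bounded uA Ocube cf.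
have [||Q dQ [_ BQ]] :=
  HC setT (sup_bound (d := d)) _ g M (sup_gauge (ltW s0)) I cubeO starO Ocube.
- move=> h; split => // y dy; have [x _ xy] := dy 0%N (leq0n r).
  rewrite mulr0n addr0 in xy; rewrite -xy in dy *.
  have dx := difference_domain_affine uA dy.
  rewrite finite_difference_affine// gE' -lee_fin.
  apply: le_trans fr; apply: le_trans (modulus_ge +oo%E f r0 (ex_intro _ x dx)).
  rewrite /Lp_norm eqxx; apply: ereal_sup_ubound; right.
  by exists x => //; exact: subset_closure.
- by split => // y /cubeO[x Ox <-]; rewrite gE fM.
have [q rq qE] := poly_of_degree_lt_affine A b dQ.
exists q => //; apply: sup_norm_le => // x Ox.
by rewrite -qE -gE (le_trans (BQ _ _)) ?ler_norm//; exists x.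
Qed.

Lemma difference_domain_measurable (Omega : set V) r h :
  measurable (Omega : set T) -> measurable (difference_domain Omega r h : set T).
Proof.
move=> mO; rewrite (_ : difference_domain _ _ _ =
    \bigcap_(j in [set: 'I_r.+1]) [set x | Omega (x + h *+ j)]).
  by apply: fin_bigcap_measurable => // j _; exact: measurable_shift.
apply/seteqP; split => x dx; first by move=> j _; apply: dx; rewrite -ltnS.
by move=> j jr; have := dx (Ordinal (jr : (j < r.+1)%N)) I.
Qed.

Lemma measurable_finite_difference r h (F : V -> R) :
  measurable_fun setT (F : T -> R) ->
  measurable_fun setT (finite_difference r h F : T -> R).
Proof.
move=> mF; apply: measurable_sum => j.
exact: measurable_funM (measurable_cst _) (measurableT_comp mF (measurable_fun_shift _)).
Qed.

Lemma measurable_poly_fun (q : mpoly d.+1 R) :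
  measurable_fun setT (poly_fun q : T -> R).
Proof.
have : poly_of_degree_lt (mmeasure mdeg q) (poly_fun q).
  by exists q => //; rewrite /poly_space /=.
move=> /(measurable_poly_aff 1%:M 0); congr (measurable_fun _ _).
by apply/funext => x; rewrite /affine_map mulmx1 addr0.
Qed.

Lemma Lp_norm_fin (p : R) (Omega : set V) (f : V -> R) : 0 < p ->
  (Lp_norm p%:E Omega f `^ p)%E = (\int[lam]_x (`|(f \_ Omega) x| `^ p)%:E)%E.
Proof. by move=> p0; rewrite /Lp_norm /= poweR_Lnorm// gt_eqF. Qed.

Lemma Lp_norm_le (p : R) (Omega : set V) (f : V -> R) (c : R) : 0 < p -> 0 <= c ->
  (\int[lam]_x (`|(f \_ Omega) x| `^ p)%:E <= c%:E)%E ->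
  (Lp_norm p%:E Omega f <= (c `^ p^-1)%:E)%E.
Proof.
move=> p0 c0; rewrite -Lp_norm_fin//.
have : (0 <= Lp_norm p%:E Omega f)%E by rewrite /Lp_norm /= Lnorm_ge0.
case: (Lp_norm _ _ _) => [n| |]//; last by rewrite poweRyr ?gt_eqF.
rewrite poweR_EFin !lee_fin => n0 npc.
rewrite -[leLHS]powRr1// -(divff (lt0r_neq0 p0)) powRrM.
by apply: ge0_ler_powR; rewrite ?nnegrE ?invr_ge0 ?powR_ge0// ltW.
Qed.

Lemma measurable_powR_norm (p : R) (F : T -> R) : measurable_fun setT F ->
  measurable_fun setT (fun x => (`|F x| `^ p)%:E).
Proof.
move=> mF; apply/measurable_EFinP; apply: (measurableT_comp (measurable_powR p)).
exact: (measurableT_comp (@normr_measurable R setT) mF).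
Qed.

Theorem whitney_finite (p : R) r rho : 0 < p -> (0 < r)%N ->
  exists2 C : R, 0 <= C &
  forall (Omega : set V) f, star_class rho Omega -> Lp_space p%:E Omega f ->
  (modulus r f Omega p%:E <= 1)%E ->
  exists2 q, poly_space r q & (Lp_norm p%:E Omega (f \- poly_fun q)%R <= C%:E)%E.
Proof.
move=> p0 r0; pose eta : R := d.+1%:R^-1; pose s := eta / 2 / r.+1%:R ^+ 2.
have eta0 : 0 < eta by rewrite invr_gt0.
have s0 : 0 < s by rewrite !divr_gt0// exprn_gt0.
have seta : 2 * s * r.+1%:R ^+ 2 <= eta.
  by rewrite /s mulrA divfK ?expf_neq0 ?pnatr_eq0// mulrC divfK.
have [C HC] := @gauge_whitney R d (2 `^ p) (2 ^+ d.+1) s (fun c => c `^ p^-1)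
  (fun a => `|a| `^ p) s0 r eta rho r0 seta.
exists (`|C| `^ p^-1); first exact: powR_ge0.
move=> Omega f [A [b [uA star Orho]]] Lf fr.
pose F : V -> R := f \_ Omega.
have LF : F \in Lfun lam p%:E by [].
have mF : measurable_fun setT (F : T -> R) by move: LF => /andP[/set_mem].
have mFp := measurable_powR_norm p mF.
have p_ge0 := ltW p0.
(* On a null Omega, in particular an empty one, every norm is 0 and the zero polynomial will do. *)
have [mu0|mu0] := eqVneq (mu Omega) 0%E.
  exists (mpolyC d.+1 0); first by rewrite /poly_space /= mmeasureC eqxx.
  apply: Lp_norm_le => //.
  have -> : (f \- poly_fun (mpolyC d.+1 0))%R = f.
    by apply/funext => x; rewrite /poly_fun /= mevalC subr0.
  apply: (@le_trans _ _ 0%E); last by rewrite lee_fin.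
  rewrite -(integral0 lam setT); apply: ae_ge0_le_integral.
  - exact: measurableT.
  - by move=> x _; rewrite lee_fin powR_ge0.
  - exact: mFp.
  - by [].
  - exact: measurable_cst.
  exists Omega; split; [exact: null_measurable|exact: mu0|].
  move=> x /= nP; apply: contrapT => Ox; apply: nP => _.
  by rewrite patchE memNset// normr0 powR0 ?gt_eqF.
have On0 : Omega !=set0.
  by apply/set0P; apply: contraNneq mu0 => ->; rewrite lebesgue_outer0.
have [starO cubeO Ocube] := star_class_cube star Orho On0.
have mO : measurable (Omega : set T) := star_measurable uA eta0 starO Ocube.
pose aff := affine_map A b.
have /fineK : mu (aff @^-1` cube s) \is a fin_num.
  by rewrite ge0_fin_numE ?lebesgue_outer_ge0// affine_cube_fin.
set v := fine _ => /esym muK.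
(* Otherwise the dilated cube that contains Omega would be null as well. *)
have v0 : 0 < v.
  have v_ge0 : 0 <= v by rewrite fine_ge0 ?lebesgue_outer_ge0.
  rewrite lt_neqAle v_ge0 andbT eq_sym; apply: contraNneq mu0 => v0.
  rewrite eq_le lebesgue_outer_ge0 andbT.
  pose t := `|rho| / s + 1; have t0 : 0 < t by rewrite ltr_wpDl// divr_ge0// ltW.
  have : (mu Omega <= mu (aff @^-1` cube (t * s)))%E.
    apply: le_lebesgue_outer => x Ox.
    have xr : `|aff x| <= rho by apply: Ocube; exists x.
    rewrite /cube /= (le_trans xr)// /t mulrDl mul1r divfK ?gt_eqF//.
    by rewrite (le_trans (ler_norm _))// lerDl ltW.
  by rewrite (affine_cube_scale b b s uA t0) muK v0 mule0.
pose tau := v `^ (- p^-1).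
have tau0 : 0 < tau by rewrite powR_gt0.
have tauv : tau `^ p * v = 1.
  by rewrite /tau -powRrM mulNr mulVf ?gt_eqF// powR_inv1 ?(ltW v0)// mulVf ?gt_eqF.
have tauK (y : R) : tau * `|tau^-1 * y| = `|y|.
  by rewrite normrM normfV (gtr0_norm tau0) mulrA divff ?gt_eqF// mul1r.
(* The factor cancels the [tau] inside [Lp_bound], so the size of [g] is the integral of |F|^p and
   the bound 1 on the modulus becomes the bound 1 on the size of the differences. *)
pose g y := tau^-1 * F ((y - b) *m invmx A).
have gE x : g (aff x) = tau^-1 * F x by rewrite /g /aff addrK mulmxK.
have mg : affine_mfun A b g.
  rewrite /affine_mfun /=; under eq_fun do rewrite -/aff gE.
  exact: measurable_funM (measurable_cst _) mF.
have gau := Lp_gauge p0 uA tau0 (ltW s0) v0 muK tauv.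
have gdiff h : Lp_bound p A b tau (difference_domain (aff @` Omega) r h)
    (finite_difference r h g) 1.
  pose h' := h *m invmx A; pose D := difference_domain Omega r h'.
  have [Dn0|D0] := pselect (D !=set0); last first.
    exists (cst 0%E); split => //; last by rewrite integral0.
    move=> x dx; exfalso; apply: D0; exists x.
    exact: difference_domain_affine dx.
  pose phi := finite_difference r h' f.
  have phiE x : D x -> phi x = finite_difference r h' F x.
    move=> Dx; apply: eq_bigr => j _; congr (_ * _).
    by rewrite /F patchE mem_set//; apply: Dx; rewrite -ltnS.
  have mD : measurable (D : set T) by exact: difference_domain_measurable.
  have mphi : measurable_fun setT (phi \_ D : T -> R).
    rewrite (_ : phi \_ D = (finite_difference r h' F) \_ D).
      apply/(measurable_restrictT _ mD); apply: measurable_funTS.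
      exact: measurable_finite_difference.
    by apply/funext => x; rewrite !patchE; case: ifP => // /set_mem /phiE.
  exists (fun x => (`|(phi \_ D) x| `^ p)%:E); split.
  - exact: measurable_powR_norm.
  - by move=> x; rewrite lee_fin powR_ge0.
  - move=> x /(difference_domain_affine uA) Dx.
    rewrite patchE mem_set// phiE// lee_fin finite_difference_affine//.
    rewrite (_ : finite_difference r _ _ x = tau^-1 * finite_difference r h' F x).
      by rewrite tauK.
    rewrite /finite_difference mulr_sumr; apply: eq_bigr => j _.
    by rewrite -/aff gE mulrCA.
  - rewrite -Lp_norm_fin//.
    have N1 : (Lp_norm p%:E D phi <= 1)%E by exact: le_trans (modulus_ge _ _ r0 Dn0) fr.
    have N0 : (0 <= Lp_norm p%:E D phi)%E by rewrite /Lp_norm /= Lnorm_ge0.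
    rewrite -[leRHS](poweR1r p); apply: gt0_ler_poweR => //.
    + by rewrite in_itv/= N0 leey.
    + by rewrite in_itv/= lee01 leey.
have [c gc] : exists c, Lp_bound p A b tau (cube eta) g c.
  have Ffin : (\int[lam]_x (`|F x| `^ p)%:E)%E \is a fin_num.
    rewrite ge0_fin_numE; last by apply: integral_ge0 => x _; rewrite lee_fin powR_ge0.
    rewrite -Lp_norm_fin//; apply: poweR_lty; rewrite /Lp_norm /=.
    by move: LF => /andP[_ /set_mem].
  exists (fine (\int[lam]_x (`|F x| `^ p)%:E)%E); exists (fun x => (`|F x| `^ p)%:E).
  split.
  - exact: mFp.
  - by move=> x; rewrite lee_fin powR_ge0.
  - by move=> x _; rewrite -/aff gE tauK.
  - by rewrite fineK.
have [Q dQ [G [mG G0 GO GC]]] := HC _ _ _ g c gau mg cubeO starO Ocube gdiff gc.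
have [q rq qE] := poly_of_degree_ltZ tau (poly_of_degree_lt_affine A b dQ).
exists q => //; apply: Lp_norm_le => //.
apply: (@le_trans _ _ (\int[lam]_x G x)%E); last first.
  by rewrite (le_trans GC)// lee_fin ler_norm.
apply: (ge0_le_integral lam measurableT).
- by move=> x _; rewrite lee_fin powR_ge0.
- apply: measurable_powR_norm; apply/(measurable_restrictT _ mO).
  apply: (@measurable_funB _ T R (Omega : set T) f (poly_fun q)).
    exact/(measurable_restrictT _ mO).
  exact/measurable_funTS/measurable_poly_fun.
- exact: mG.
move=> x _; rewrite patchE; case: ifP => [/set_mem Ox|_]; last first.
  by rewrite normr0 powR0 ?gt_eqF.
apply: le_trans (GO x _); last by exists x.
rewrite -/aff gE lee_fin -qE -(tauK (_ - _)) /= mulrBr mulKf ?gt_eqF//.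
by rewrite /F patchE mem_set.
Qed.

End WhitneyInequality.

Theorem theorem3p3 (R : realType) (d r : nat) (p : \bar R) (rho : R)
    (hr : (0 < r)%N) (hp : (0 < p)%E) (hrho : 1 < rho) :
  exists C : R,
    (ereal_sup [set whitney_constant r Omega p
                 | Omega in (star_class rho : set (set 'rV[R]_d.+1))] <= C%:E)%E.
Proof.
have [C HC] : exists C : R, forall (Omega : set 'rV[R]_d.+1) f,
    star_class rho Omega -> Lp_space p Omega f -> (modulus r f Omega p <= 1)%E ->
    exists2 q, poly_space r q & (Lp_norm p Omega (f \- poly_fun q)%R <= C%:E)%E.
  case: p hp => [p|_|//]; last by have [C _] := @whitney_sup R d r rho hr; exists C.
  rewrite lte_fin => p0.
  by have [C _] := @whitney_finite R d p r rho p0 hr; exists C.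
exists C; apply: ge_ereal_sup => _ [D sO <-].
apply: ge_ereal_sup => _ [f [Lf fr] <-]; have [q rq qC] := HC _ _ sO Lf fr.
by apply: le_trans qC; apply: ereal_inf_lbound; exists q.
Qed.
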